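(* For all integers $m\geq 0$ and $n\geq 1$, \[ N(\leq m,n)\geq M(\leq m,n)\geq N(\leq m-1,n). \]
   Context: For a partition $\lambda$, $\operatorname{rank}(\lambda)$ is its largest part minus its number of parts. $\operatorname{crank}(\lambda)$ is the largest part of $\lambda$ if $\lambda$ contains no part equal to $1$; otherwise it is the number of parts larger than the number of ones minus the number of ones. For $n\geq1$, $N(m,n)$ is the number of partitions of $n$ with rank $m$. For $n>1$, $M(m,n)$ is the number of partitions of $n$ with crank $m$. For $n=1$ one sets $M(0,1)=-1$, $M(1,1)=M(-1,1)=1$ and $M(m,1)=0$ for $m\notin\{-1,0,1\}$. The cumulative functions are $N(\leq m,n)=\sum_{r\leq m}N(r,n)$ and $M(\leq m,n)=\sum_{r\leq m}M(r,n)$. *)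

(* Defs.v *)
From mathcomp Require Import all_boot all_order all_algebra.
Set Implicit Arguments. Unset Strict Implicit. Unset Printing Implicit Defensive.
Import Order.TTheory GRing.Theory Num.Theory.
Local Open Scope ring_scope.

Definition is_partition (n : nat) (s : seq nat) : bool :=
  [&& sorted geq s, all (fun x => (0 < x)%N) s & sumn s == n].

Fixpoint seqs_len (b k : nat) : seq (seq nat) :=
  match k with
  | 0 => [:: [::]]
  | k'.+1 => [seq x :: s | x <- iota 1 b, s <- seqs_len b k']
  end.

(* Candidate list: every partition of n has at most n parts, each <= n. *)
Definition candidates (n : nat) : seq (seq nat) :=
  flatten [seq seqs_len n k | k <- iota 0 n.+1].

Definition partitions (n : nat) : seq (seq nat) :=
  [seq s <- candidates n | is_partition n s].

Definition largest_part (s : seq nat) : nat := foldr maxn 0 s.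

Definition rank (s : seq nat) : int := (largest_part s)%:Z - (size s)%:Z.

Definition crank (s : seq nat) : int :=
  let omega := count (pred1 1) s in
  if omega == 0%N then (largest_part s)%:Z
  else (count (fun x => (omega < x)%N) s)%:Z - omega%:Z.

Definition Nrank (m : int) (n : nat) : int :=
  (count (fun s => rank s == m) (partitions n))%:Z.

Definition Mcrank (m : int) (n : nat) : int :=
  if n == 1%N then
    (if m == 0 then -1 else if (m == 1) || (m == -1) then 1 else 0)
  else (count (fun s => crank s == m) (partitions n))%:Z.

(* Cumulative function sum_{r <= m} F(r,n).  For n >= 1 both N(r,n) and M(r,n)
   vanish for r < -n, so the sum is the finite sum over -n <= r <= m,
   i.e. over r = m - i with 0 <= i <= m + n. *)
Definition nat_of_int_trunc (z : int) : nat := if z is Posz k then k else 0.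

Definition cumul (F : int -> nat -> int) (m : int) (n : nat) : int :=
  \sum_(i < nat_of_int_trunc (m + n%:Z + 1)) F (m - i%:Z) n.

Definition Nle (m : int) (n : nat) : int := cumul Nrank m n.
Definition Mle (m : int) (n : nat) : int := cumul Mcrank m n.

(* Main.v *)
(** Let [N_k] and [M_k] be the generating functions of the partitions with rank,
    respectively crank, at least [k].  Complementing, the two inequalities say that
    [M_(k+1) - N_(k+1)] and [N_k - M_(k+1)] have nonnegative coefficients.

    Sorting by Durfee rectangles writes [N_k] as a sum of series
    [Th P u v = \sum_(a, b | P (a - b)) E u a * E v b], where [E u a] counts the
    partitions into [a] parts at most [u]; counting by the number of ones writes
    [M_(k+1)] with the same rectangles and no constraint on [a - b].  Telescoping and
    the reflection [Th_flip] reduce [N_k - M_(k+1)] to [M_(k+2) - N_(k+2)] plus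
    positive terms, and [M_(k+1) - N_(k+1)] to a sum of the series [pos_term].

    For the latter, Heine's transformation turns the series [Th (a - b = 1)] and
    [Th (a - b = 2)] into sums over [j] of products of Gaussian binomials with a
    common denominator [(q^2; q)_n].  After adding a telescoping sum, every numerator
    is a combination of powers of [q] and of [1 - q ^ i] for factors [1 - q ^ i] of the
    denominator, apart from boundary terms, which are handled separately. *)

Require Import Defs.
From HB Require Import structures.
From mathcomp Require Import all_boot all_order all_algebra.
From mathcomp Require boolp.
From mathcomp Require Import zify ring.
Import Order.TTheory GRing.Theory Num.Theory.
Local Open Scope ring_scope.
Set Implicit Arguments. Unset Strict Implicit. Unset Printing Implicit Defensive.

(** * Formal power series *)

Record fps := Fps { co : nat -> int }.

HB.instance Definition _ := boolp.gen_eqMixin fps.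
HB.instance Definition _ := boolp.gen_choiceMixin fps.

Lemma fpsP (a b : fps) : co a =1 co b -> a = b.
Proof. by case: a b => [f] [g] /= fg; rewrite (boolp.funext fg). Qed.

Definition fps_zero := Fps (fun=> 0).
Definition fps_add (a b : fps) := Fps (fun n => co a n + co b n).
Definition fps_opp (a : fps) := Fps (fun n => - co a n).

Lemma fps_addA : associative fps_add.
Proof. by move=> a b c; apply: fpsP => n /=; rewrite addrA. Qed.
Lemma fps_addC : commutative fps_add.
Proof. by move=> a b; apply: fpsP => n /=; rewrite addrC. Qed.
Lemma fps_add0 : left_id fps_zero fps_add.
Proof. by move=> a; apply: fpsP => n /=; rewrite add0r. Qed.
Lemma fps_addN : left_inverse fps_zero fps_opp fps_add.
Proof. by move=> a; apply: fpsP => n /=; rewrite addNr. Qed.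

HB.instance Definition _ :=
  GRing.isZmodule.Build fps fps_addA fps_addC fps_add0 fps_addN.

Definition fps_one := Fps (fun n => (n == 0%N)%:R).
Definition fps_mul (a b : fps) :=
  Fps (fun n => \sum_(i < n.+1) co a i * co b (n - i)%N).

Definition fps_trunc (N : nat) (a : fps) : {poly int} := \poly_(i < N) co a i.

Lemma coef_trunc N a k : (k < N)%N -> (fps_trunc N a)`_k = co a k.
Proof. by move=> kN; rewrite coef_poly kN. Qed.

(** Coefficient [k] of a product depends only on the truncations beyond [k], so commutativity and
    associativity are inherited from [{poly int}]. *)
Lemma co_mul_trunc N a b k :
  (k < N)%N -> co (fps_mul a b) k = (fps_trunc N a * fps_trunc N b)`_k.
Proof.
move=> kN; rewrite coefM /=; apply: eq_bigr => i _.
by rewrite !coef_trunc //; have := ltn_ord i; lia.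
Qed.

Lemma fps_mulC : commutative fps_mul.
Proof.
move=> a b; apply: fpsP => n.
by rewrite !(@co_mul_trunc n.+1) // mulrC.
Qed.

Lemma fps_mulA : associative fps_mul.
Proof.
move=> a b c; apply: fpsP => n.
have H x y z : co (fps_mul x (fps_mul y z)) n
    = (fps_trunc n.+1 x * (fps_trunc n.+1 y * fps_trunc n.+1 z))`_n.
  rewrite [LHS]/= coefM; apply: eq_bigr => i _.
  rewrite coef_trunc // -(@co_mul_trunc n.+1) //; lia.
by rewrite H fps_mulC H mulrA mulrC.
Qed.

Lemma fps_mul1 : left_id fps_one fps_mul.
Proof.
move=> a; apply: fpsP => n /=.
rewrite big_ord_recl /= mul1r subn0 big1 ?addr0 // => i _.
by rewrite mul0r.
Qed.

Lemma fps_mulDl : left_distributive fps_mul fps_add.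
Proof.
move=> a b c; apply: fpsP => n /=.
by rewrite -big_split; apply: eq_bigr => i _; rewrite mulrDl.
Qed.

Lemma fps_oner_neq0 : fps_one != 0.
Proof. by apply/eqP => /(congr1 (fun a => co a 0)). Qed.

HB.instance Definition _ := GRing.Zmodule_isComNzRing.Build fps
  fps_mulA fps_mulC fps_mul1 fps_mulDl fps_oner_neq0.

Lemma coD (a b : fps) n : co (a + b) n = co a n + co b n. Proof. by []. Qed.
Lemma coN (a : fps) n : co (- a) n = - co a n. Proof. by []. Qed.
Lemma coB (a b : fps) n : co (a - b) n = co a n - co b n. Proof. by []. Qed.
Lemma co1 n : co 1 n = (n == 0%N)%:R. Proof. by []. Qed.
Lemma coM (a b : fps) n :
  co (a * b) n = \sum_(i < n.+1) co a i * co b (n - i)%N.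
Proof. by []. Qed.

Lemma co_sum (I : Type) (r : seq I) (P : pred I) (F : I -> fps) n :
  co (\sum_(i <- r | P i) F i) n = \sum_(i <- r | P i) co (F i) n.
Proof. by elim/big_rec2: _ => // i x y _ <-; rewrite coD. Qed.

Definition q : fps := Fps (fun n => (n == 1%N)%:R).

Lemma co_qM (a : fps) n : co (q * a) n = if n is n'.+1 then co a n' else 0.
Proof.
rewrite coM; case: n => [|n]; first by rewrite big_ord1 mul0r.
rewrite big_ord_recl mul0r add0r big_ord_recl /= mul1r subn1 big1 ?addr0 //.
by move=> i _; rewrite mul0r.
Qed.

Lemma co_qXM m (a : fps) n :
  co (q ^+ m * a) n = if (n < m)%N then 0 else co a (n - m)%N.
Proof.
elim: m n => [|m IH] n; first by rewrite expr0 mul1r subn0.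
by rewrite exprS -mulrA co_qM; case: n => [|n] //; rewrite IH ltnS subSS.
Qed.

Lemma co_qX m n : co (q ^+ m) n = (n == m)%:R.
Proof.
rewrite -[q ^+ m]mulr1 co_qXM co1; case: ltnP => [|mn].
  by move=> nm; rewrite (_ : (n == m) = false) //; apply/negbTE; lia.
by congr (_%:R); congr nat_of_bool; lia.
Qed.

(** * Series with nonnegative coefficients *)

Definition nn (a : fps) := forall n, 0 <= co a n.

Lemma nnD a b : nn a -> nn b -> nn (a + b).
Proof. by move=> ha hb n; rewrite coD addr_ge0. Qed.
Lemma nnM a b : nn a -> nn b -> nn (a * b).
Proof. by move=> ha hb n; rewrite coM sumr_ge0 // => i _; rewrite mulr_ge0. Qed.
Lemma nn0 : nn 0. Proof. by []. Qed.
Lemma nn1 : nn 1. Proof. by move=> n; rewrite co1 ler0n. Qed.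
Lemma nnq : nn q. Proof. by move=> n; rewrite /= ler0n. Qed.
Lemma nnX a m : nn a -> nn (a ^+ m).
Proof.
by move=> ha; elim: m => [|m IH]; [exact: nn1 | rewrite exprS; exact: nnM].
Qed.
Lemma nn_nat m : nn m%:R.
Proof.
elim: m => [|m IH]; first exact: nn0.
by rewrite -addn1 natrD; apply: nnD; last exact: nn1.
Qed.
Lemma nn_sum (I : Type) (r : seq I) (P : pred I) (F : I -> fps) :
  (forall i, P i -> nn (F i)) -> nn (\sum_(i <- r | P i) F i).
Proof. by move=> h; apply: big_ind => [|a b|]; [exact: nn0 | exact: nnD | exact: h]. Qed.
Lemma nn_prod (I : Type) (r : seq I) (P : pred I) (F : I -> fps) :
  (forall i, P i -> nn (F i)) -> nn (\prod_(i <- r | P i) F i).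
Proof. by move=> h; apply: big_ind => [|a b|]; [exact: nn1 | exact: nnM | exact: h]. Qed.

(** For [m > 0] this is 1 / (1 - q^m). *)
Definition geo (m : nat) : fps := Fps (fun n => (m %| n)%:R).

Lemma nn_geo m : nn (geo m). Proof. by move=> n; rewrite /= ler0n. Qed.

Lemma geoE m : (0 < m)%N -> (1 - q ^+ m) * geo m = 1.
Proof.
move=> m0; apply: fpsP => n; rewrite mulrBl mul1r coB co_qXM co1 /=.
case: ltnP => [nm|mn].
  rewrite subr0; case: n nm => [|n] nm; first by rewrite dvdn0.
  by rewrite gtnNdvd.
rewrite dvdn_subl // subrr (_ : (n == 0%N) = false) //.
by apply/negbTE; lia.
Qed.

(** This stands in for division: identities with denominators are proved after multiplying both
    sides by the factors 1 - q^m. *)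
Lemma geo_lreg m (a b : fps) :
  (0 < m)%N -> (1 - q ^+ m) * a = (1 - q ^+ m) * b -> a = b.
Proof.
move=> m0 h; have: geo m * ((1 - q ^+ m) * a) = geo m * ((1 - q ^+ m) * b).
  by rewrite h.
by rewrite !mulrA [geo m * _]mulrC geoE // !mul1r.
Qed.

(** * Divisibility by powers of q *)

Definition ord (a : fps) (m : nat) := forall n, (n < m)%N -> co a n = 0.

Lemma ordM a b m : ord b m -> ord (a * b) m.
Proof.
move=> hb n nm; rewrite coM big1 // => i _; rewrite hb ?mulr0 //; lia.
Qed.
Lemma ordMl a b m : ord a m -> ord (a * b) m.
Proof. by rewrite mulrC; apply: ordM. Qed.
Lemma ordD a b m : ord a m -> ord b m -> ord (a + b) m.
Proof. by move=> ha hb n nm; rewrite coD ha ?hb. Qed.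
Lemma ordB a b m : ord a m -> ord b m -> ord (a - b) m.
Proof. by move=> ha hb n nm; rewrite coB ha ?hb. Qed.
Lemma ordX m k : (k <= m)%N -> ord (q ^+ m) k.
Proof. by move=> km n nk; rewrite co_qX (_ : (n == m) = false) //; lia. Qed.
Lemma ord_le a m k : (k <= m)%N -> ord a m -> ord a k.
Proof. by move=> km h n nk; apply: h; lia. Qed.
Lemma ordXM a m k : (k <= m)%N -> ord (q ^+ m * a) k.
Proof. by move=> km; apply: ordMl; apply: ordX. Qed.


(** Infinite sums of series [f i] with [f i] divisible by [q ^ i]. *)
Definition ssum (f : nat -> fps) : fps :=
  Fps (fun n => \sum_(i < n.+1) co (f i) n).

Definition summable (f : nat -> fps) := forall i, ord (f i) i.

Lemma co_ssum f B n : summable f -> (n < B)%N ->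
  co (ssum f) n = \sum_(i < B) co (f i) n.
Proof.
move=> hf nB; rewrite /= -(subnKC nB) big_split_ord /= [X in _ + X]big1 ?addr0 //.
by move=> i _; apply: hf => /=; lia.
Qed.

Lemma eq_ssum f g : f =1 g -> ssum f = ssum g.
Proof. by move=> fg; apply: fpsP => n; apply: eq_bigr => i _; rewrite fg. Qed.

Lemma ssumD f g : ssum (fun i => f i + g i) = ssum f + ssum g.
Proof. by apply: fpsP => n; rewrite coD /= -big_split. Qed.

Lemma ssumN f : ssum (fun i => - f i) = - ssum f.
Proof. by apply: fpsP => n; rewrite coN /= -sumrN. Qed.

Lemma ssumB f g : ssum (fun i => f i - g i) = ssum f - ssum g.
Proof. by rewrite ssumD ssumN. Qed.

Lemma ssumMl a f : summable f -> ssum (fun i => a * f i) = a * ssum f.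
Proof.
move=> hf; apply: fpsP => n; rewrite coM.
rewrite -[LHS]/(\sum_(i < n.+1) co (a * f i) n).
under eq_bigr do rewrite coM.
rewrite exchange_big /=; apply: eq_bigr => j _.
rewrite -mulr_sumr; congr (_ * _).
have -> : \sum_(i < (n - j).+1) co (f i) (n - j) = co (ssum f) (n - j) by [].
by rewrite (@co_ssum _ n.+1) //; lia.
Qed.

Lemma ssum_recl f : summable f -> ssum f = f 0%N + ssum (fun i => f i.+1).
Proof.
move=> hf; apply: fpsP => n; rewrite coD (@co_ssum _ n.+2) // big_ord_recl.
by congr (_ + _).
Qed.

Lemma ssum_telescope g : summable g -> ssum (fun i => g i - g i.+1) = g 0%N.
Proof. by move=> hg; rewrite ssumB {1}ssum_recl // addrK. Qed.

Lemma nn_ssum f : (forall i, nn (f i)) -> nn (ssum f).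
Proof. by move=> h n /=; apply: sumr_ge0 => i _; apply: h. Qed.

Lemma ord_ssum f m : (forall i, ord (f i) m) -> ord (ssum f) m.
Proof. by move=> h n nm /=; rewrite big1 // => i _; apply: h. Qed.

(** On both sides, coefficient [n] is a finite sum over the square i, j <= n. *)
Lemma ssum_exchange (f : nat -> nat -> fps) :
  ssum (fun i => ssum (f i)) = ssum (fun j => ssum (f ^~ j)).
Proof. by apply: fpsP => n /=; rewrite exchange_big. Qed.

Lemma ssum0 : ssum (fun=> 0) = 0.
Proof. by apply: fpsP => n /=; rewrite big1. Qed.

Lemma ssum_single f b : ord (f b) b -> (forall i, i != b -> f i = 0) ->
  ssum f = f b.
Proof.
move=> fb f0; apply: fpsP => n; case: (ltnP b n.+1) => [bn|nb].
  rewrite -[LHS]/(\sum_(i < n.+1) co (f i) n).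
  rewrite (bigD1 (Ordinal bn)) //= big1 ?addr0 // => i ib.
  by rewrite f0.
rewrite -[LHS]/(\sum_(i < n.+1) co (f i) n) fb // big1 // => i _.
by rewrite f0 //; have := ltn_ord i; lia.
Qed.

(** * Restricted partitions and their generating functions *)

Ltac qring :=
  rewrite ?(addSn, addnS, mulSn, mulnS, mulnDl, mulnDr, exprS, exprD,
            addn0, add0n, muln0, mul0n, expr0); ring.

(** Gaussian binomial [u+a choose a]: partitions with at most [a] parts, all at most [u]. *)
Fixpoint G (u : nat) : nat -> fps :=
  match u with
  | 0 => fun _ => 1
  | u'.+1 => fix Gu a :=
      match a with 0 => 1 | a'.+1 => G u' a'.+1 + q ^+ u * Gu a' end
  end.

Lemma G0n a : G 0 a = 1. Proof. by []. Qed.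
Lemma Gn0 u : G u 0 = 1. Proof. by case: u. Qed.
Lemma GSS u a : G u.+1 a.+1 = G u a.+1 + q ^+ u.+1 * G u.+1 a.
Proof. by []. Qed.

(** The conjugate Pascal rule: either there are at most [a] parts, or 1 can be taken off each of the
    [a.+1] parts. Comparing it with [GSS] yields [G_cross] and the ratios of neighbouring
    binomials. *)
Lemma GSS' u a : G u.+1 a.+1 = G u.+1 a + q ^+ a.+1 * G u a.+1.
Proof.
elim: u a => [|u IHu] a.
  elim: a => [|a IHa]; first by rewrite !GSS !G0n !Gn0; ring.
  by rewrite [LHS]GSS [in LHS]IHa [in RHS]GSS !G0n; qring.
elim: a => [|a IHa].
  by rewrite [LHS]GSS [in LHS]IHu [in RHS]GSS !Gn0; qring.
by rewrite [LHS]GSS [in LHS]IHu [in LHS]IHa [G u.+2 a.+1]GSS [G u.+1 a.+2]GSS; qring.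
Qed.

Lemma G_cross u a :
  (1 - q ^+ a.+1) * G u a.+1 = (1 - q ^+ u.+1) * G u.+1 a.
Proof.
by have := GSS u a; rewrite GSS' => /eqP; rewrite -subr_eq0 => /eqP h; 
  apply/eqP; rewrite -subr_eq0 -oppr_eq0 -h; apply/eqP; ring.
Qed.

Lemma G_ratio_l u a :
  (1 - q ^+ u.+1) * G u.+1 a = (1 - q ^+ (u + a).+1) * G u a.
Proof.
case: a => [|a]; first by rewrite !Gn0 addn0.
by rewrite GSS mulrDr mulrCA -G_cross; qring.
Qed.

Lemma G_ratio_r u a :
  (1 - q ^+ a.+1) * G u a.+1 = (1 - q ^+ (u + a).+1) * G u a.
Proof. by rewrite G_cross G_ratio_l. Qed.

Lemma nn_G u a : nn (G u a).
Proof.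
elim: u a => [|u IHu]; first by move=> a; exact: nn1.
elim=> [|a IHa]; first exact: nn1.
by apply: nnD => //; apply: nnM => //; apply: nnX; exact: nnq.
Qed.

(** Partitions into exactly [a] parts, all at most [u]. *)
Definition E (u a : nat) : fps :=
  if u is u'.+1 then q ^+ a * G u' a else (a == 0%N)%:R.

Lemma E0 u : E u 0 = 1. Proof. by case: u => [|u] //=; rewrite Gn0 mul1r. Qed.
Lemma E0S a : E 0 a.+1 = 0. Proof. by []. Qed.
Lemma ES u a : E u.+1 a = q ^+ a * G u a. Proof. by []. Qed.
Lemma ESS u a : E u.+1 a.+1 = E u a.+1 + q ^+ u.+1 * E u.+1 a.
Proof. by case: u => [|u]; rewrite !ES ?G0n ?E0S ?GSS; qring. Qed.

Lemma ord_E u a : ord (E u a) a.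
Proof.
case: u => [|u]; last by apply: ordXM.
by case: a => [|a] n //; rewrite E0S.
Qed.

Lemma nn_E u a : nn (E u a).
Proof.
case: u => [|u]; first exact: nn_nat.
by apply: nnM; [apply: nnX; exact: nnq | exact: nn_G].
Qed.

Lemma G_E u a : G u a.+1 = G u a + E u a.+1.
Proof. by case: u => [|u]; rewrite ?G0n ?E0S ?addr0 // GSS'. Qed.

(** [1 / (q; q)_u]. *)
Definition iq (u : nat) : fps := \prod_(1 <= i < u.+1) geo i.

Lemma iq0 : iq 0 = 1. Proof. by rewrite /iq big_nil. Qed.
Lemma iqS u : iq u.+1 = iq u * geo u.+1.
Proof. by rewrite /iq big_nat_recr. Qed.
Lemma iqE u : (1 - q ^+ u.+1) * iq u.+1 = iq u.
Proof. by rewrite iqS mulrCA geoE // mulr1. Qed.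

(** Pairs [(alpha, beta)] of partitions with parts at most [u] and [v], whose
    numbers of parts [a] and [b] satisfy [P (a - b)]. *)
Definition Th (P : pred int) (u v : nat) : fps :=
  ssum (fun a => ssum (fun b => (P (a%:Z - b%:Z))%:R * (E u a * E v b))).

Lemma Th_in_ord P u v a b : ord ((P (a%:Z - b%:Z))%:R * (E u a * E v b)) b.
Proof. by apply: ordM; apply: ordM; exact: ord_E. Qed.
Lemma Th_in_ord' P u v a b : ord ((P (a%:Z - b%:Z))%:R * (E u a * E v b)) a.
Proof. by apply: ordM; apply: ordMl; exact: ord_E. Qed.
Lemma Th_out_ord P u v a :
  ord (ssum (fun b => (P (a%:Z - b%:Z))%:R * (E u a * E v b))) a.
Proof. by apply: ord_ssum => b; exact: Th_in_ord'. Qed.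

Lemma eq_Th P Q u v : P =1 Q -> Th P u v = Th Q u v.
Proof.
by move=> PQ; apply: eq_ssum => a; apply: eq_ssum => b; rewrite PQ.
Qed.

Lemma nn_Th P u v : nn (Th P u v).
Proof.
apply: nn_ssum => a; apply: nn_ssum => b.
by apply: nnM; [exact: nn_nat | apply: nnM; exact: nn_E].
Qed.

Lemma Th_add (P Q R : pred int) u v :
  (forall x, nat_of_bool (P x) = (Q x + R x)%N) -> Th P u v = Th Q u v + Th R u v.
Proof.
move=> h; rewrite -ssumD; apply: eq_ssum => a; rewrite -ssumD.
by apply: eq_ssum => b; rewrite h natrD mulrDl.
Qed.

Lemma Th_exchange P u v :
  Th P u v
  = ssum (fun b => ssum (fun a => (P (a%:Z - b%:Z))%:R * (E u a * E v b))).
Proof. exact: ssum_exchange. Qed.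

(** Either alpha has no part [u.+1], or removing one such part lowers a - b by one, which shifts the
    argument of [P]. *)
Lemma ThSl P u v :
  Th P u.+1 v = Th P u v + q ^+ u.+1 * Th (fun x => P (x + 1)) u.+1 v.
Proof.
rewrite /Th [X in X = _]ssum_recl; last by move=> a; exact: (@Th_out_ord P).
rewrite [X in _ = X + _]ssum_recl; last by move=> a; exact: (@Th_out_ord P).
rewrite !E0 -addrA; congr (_ + _).
rewrite -ssumMl; last first.
  by move=> a; exact: (@Th_out_ord (fun x => P (x + 1))).
rewrite -ssumD; apply: eq_ssum => a.
rewrite -ssumMl; last by move=> b; exact: (@Th_in_ord (fun x => P (x + 1))).
rewrite -ssumD; apply: eq_ssum => b.
rewrite ESS (_ : a.+1%:Z - b%:Z = a%:Z - b%:Z + 1); last lia.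
ring.
Qed.

Lemma ThSr P u v :
  Th P u v.+1 = Th P u v + q ^+ v.+1 * Th (fun x => P (x - 1)) u v.+1.
Proof.
rewrite !Th_exchange [X in X = _]ssum_recl; last first.
  by move=> b; apply: ord_ssum => a; exact: (@Th_in_ord P).
rewrite [X in _ = X + _]ssum_recl; last first.
  by move=> b; apply: ord_ssum => a; exact: (@Th_in_ord P).
rewrite !E0 -addrA; congr (_ + _).
rewrite -ssumMl; last first.
  move=> b; apply: ord_ssum => a; exact: (@Th_in_ord (fun x => P (x - 1))).
rewrite -ssumD; apply: eq_ssum => b.
rewrite -ssumMl; last by move=> a; exact: (@Th_in_ord' (fun x => P (x - 1))).
rewrite -ssumD; apply: eq_ssum => a.
rewrite ESS (_ : a%:Z - b.+1%:Z = a%:Z - b%:Z - 1); last lia.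
ring.
Qed.

Lemma Thn0 P u : Th P u 0 = ssum (fun a => (P a%:Z)%:R * E u a).
Proof.
apply: eq_ssum => a; rewrite ssum_recl; last by move=> b; exact: (@Th_in_ord P).
rewrite (_ : ssum _ = 0) ?addr0 ?E0 ?subr0 ?mulr1 // -ssum0.
by apply: eq_ssum => b; rewrite E0S !mulr0.
Qed.

Lemma ssum_le_E u b : ssum (fun a => ((a <= b)%N)%:R * E u a) = G u b.
Proof.
have hs b' : summable (fun a => ((a <= b')%N)%:R * E u a).
  by move=> a; apply: ordM; exact: ord_E.
elim: b => [|b IH].
  rewrite ssum_recl // E0 mul1r Gn0 (_ : ssum _ = 0) ?addr0 // -ssum0.
  by apply: eq_ssum => a; rewrite mul0r.
rewrite G_E -IH.
have hd : ssum (fun a => (a == b.+1)%:R * E u a) = E u b.+1.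
  rewrite (@ssum_single _ b.+1) ?eqxx ?mul1r //; first exact: ord_E.
  by move=> i /negbTE ->; rewrite mul0r.
rewrite -hd -ssumD; apply: eq_ssum => a; rewrite -mulrDl -natrD.
by congr (_%:R * _); case: ltngtP; lia.
Qed.

Definition ple (d : int) : pred int := fun x => x <= d.
Definition pge (d : int) : pred int := fun x => d <= x.
Definition peq (d : int) : pred int := fun x => x == d.
Definition pall : pred int := fun=> true.

(** The common value behind [Th_flip]. With the larger number of parts fixed at c, the other
    partition has at most c parts and is counted by [G], while [E] with its bound raised by one is
    q^c times [G]. The result is symmetric in the two roles. *)
Definition Hs (u v : nat) : fps := ssum (fun c => q ^+ c * (G u c * G v c)).

Lemma Th_le0 u v : Th (ple 0) u v.+1 = Hs u v.
Proof.
rewrite Th_exchange; apply: eq_ssum => b; rewrite -ssum_le_E.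
rewrite [X in _ * X]mulrC mulrA -ES -ssumMl; last first.
  by move=> a; apply: ordM; exact: ord_E.
apply: eq_ssum => a; rewrite (_ : ple 0 _ = (a <= b)%N); first ring.
rewrite /ple; lia.
Qed.

Lemma Th_ge0 u v : Th (pge 0) u.+1 v = Hs u v.
Proof.
apply: eq_ssum => a; rewrite -[G v a]ssum_le_E.
rewrite mulrA -ES -ssumMl; last first.
  by move=> b; apply: ordM; exact: ord_E.
apply: eq_ssum => b; rewrite (_ : pge 0 _ = (b <= a)%N); first ring.
rewrite /pge; lia.
Qed.

Lemma Th_flip u v : Th (ple 0) u v.+1 = Th (pge 0) u.+1 v.
Proof. by rewrite Th_le0 Th_ge0. Qed.

Lemma Th_eq d u v : Th (peq d%:Z) u v = ssum (fun b => E u (b + d) * E v b).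
Proof.
rewrite Th_exchange; apply: eq_ssum => b.
have peqE a : peq d (a%:Z - b%:Z) = (a == b + d)%N by rewrite /peq; lia.
rewrite (@ssum_single _ (b + d)) ?peqE ?eqxx ?mul1r //.
  by apply: ordMl; exact: ord_E.
by move=> i /negbTE hi; rewrite peqE hi mul0r.
Qed.

Lemma Th_le_box u i : Th (ple i%:Z) u 0 = G u i.
Proof. by rewrite Thn0 -ssum_le_E; apply: eq_ssum => a. Qed.

Lemma Th_lt0_box u : Th (ple (-1)) u 0 = 0.
Proof.
by rewrite Thn0 -ssum0; apply: eq_ssum => a; rewrite (_ : ple _ _ = false) ?mul0r.
Qed.

Lemma Th_all u v : Th pall u v = iq u * iq v.
Proof.
elim: v u => [|v IHv]; last first.
  move=> u; apply: (@geo_lreg v.+1) => //.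
  rewrite [RHS]mulrCA iqE -IHv.
  have := ThSr pall u v; rewrite (@eq_Th (fun x => pall (x - 1)) pall) // => h.
  by rewrite mulrBl mul1r {1}h addrK.
elim=> [|u IHu].
  rewrite Thn0 ssum_recl; last by move=> a; apply: ordM; exact: ord_E.
  rewrite E0 iq0 !mulr1 (_ : ssum _ = 0) ?addr0 // -ssum0.
  by apply: eq_ssum => a; rewrite E0S mulr0.
apply: (@geo_lreg u.+1) => //; rewrite mulrA iqE -IHu.
have := ThSl pall u 0; rewrite (@eq_Th (fun x => pall (x + 1)) pall) // => h.
by rewrite mulrBl mul1r {1}h addrK.
Qed.

(** Since b > 0 here, shift b by one: the summand becomes q^(b+1) G y (b+1) G x b, and [G_E] splits
    G y (b+1) into at most b parts, giving [Hs], and exactly b+1 parts, giving the [peq 1] term with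
    the two sides exchanged. *)
Lemma Th_lt0_step x y :
  Th (ple (-1)) x y.+1 = q * Th (ple 0) x y.+1 + q * Th (peq 1) y x.+1.
Proof.
rewrite Th_le0 (Th_eq 1) Th_exchange.
rewrite ssum_recl; last first.
  by move=> b; apply: ord_ssum => a; exact: (@Th_in_ord (ple (-1))).
rewrite (_ : ssum (fun a => (ple (-1) (a%:Z - 0%N%:Z))%:R * _) = 0) ?add0r;
  last first.
  rewrite -ssum0; apply: eq_ssum => a.
  by rewrite (_ : ple _ _ = false) ?mul0r // /ple; apply/negbTE; lia.
rewrite -!ssumMl; last 2 first.
  by move=> b; apply: ordXM.
  by move=> b; apply: ordM; exact: ord_E.
rewrite -ssumD; apply: eq_ssum => b.
transitivity (E y.+1 b.+1 * G x b).
  rewrite -ssum_le_E -ssumMl; last by move=> a; apply: ordM; exact: ord_E.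
  apply: eq_ssum => a; rewrite (_ : ple (-1) _ = (a <= b)%N); first ring.
  by rewrite /ple; lia.
by rewrite !ES addn1 G_E; qring.
Qed.

(** * Rank and crank generating functions *)

Lemma Thple_l d u v :
  Th (ple d) u.+1 v = Th (ple d) u v + q ^+ u.+1 * Th (ple (d - 1)) u.+1 v.
Proof.
by rewrite ThSl; congr (_ + _ * _); apply: eq_Th => x; rewrite /ple; lia.
Qed.
Lemma Thple_r d u v :
  Th (ple d) u v.+1 = Th (ple d) u v + q ^+ v.+1 * Th (ple (d + 1)) u v.+1.
Proof.
by rewrite ThSr; congr (_ + _ * _); apply: eq_Th => x; rewrite /ple; lia.
Qed.
Lemma Thpge_l d u v :
  Th (pge d) u.+1 v = Th (pge d) u v + q ^+ u.+1 * Th (pge (d - 1)) u.+1 v.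
Proof.
by rewrite ThSl; congr (_ + _ * _); apply: eq_Th => x; rewrite /pge; lia.
Qed.
Lemma Thpeq_l d u v :
  Th (peq d) u.+1 v = Th (peq d) u v + q ^+ u.+1 * Th (peq (d - 1)) u.+1 v.
Proof.
by rewrite ThSl; congr (_ + _ * _); apply: eq_Th => x; rewrite /peq; lia.
Qed.
Lemma Thpeq_r d u v :
  Th (peq d) u v.+1 = Th (peq d) u v + q ^+ v.+1 * Th (peq (d + 1)) u v.+1.
Proof.
by rewrite ThSr; congr (_ + _ * _); apply: eq_Th => x; rewrite /peq; lia.
Qed.

Lemma Thple_peq d u v :
  Th (ple d) u v = Th (ple (d - 1)) u v + Th (peq d) u v.
Proof.
apply: Th_add => x; rewrite /ple /peq.
by case: (ltgtP x d) => h; case: (lerP x (d - 1)) => h' //=; lia.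
Qed.
Lemma Thpge_peq d u v :
  Th (pge d) u v = Th (pge (d + 1)) u v + Th (peq d) u v.
Proof.
apply: Th_add => x; rewrite /pge /peq.
by case: (ltgtP x d) => h; case: (lerP (d + 1) x) => h' //=; lia.
Qed.
Lemma Thpall_split d u v :
  Th pall u v = Th (ple (d - 1)) u v + Th (pge d) u v.
Proof.
apply: Th_add => x; rewrite /ple /pge /pall.
by case: (lerP x (d - 1)) => h; case: (lerP d x) => h' //=; lia.
Qed.

(** Generating function of partitions with rank at least [k]: a first row
    [k+1+i] followed by at most [i] parts. *)
Definition rank_gf (k : nat) : fps :=
  ssum (fun i => q ^+ (k + i).+1 * G (k + i).+1 i).

(** [durfee k 0] is [rank_gf k], with the (conjugate) partitions sorted by their
    [(e+1+k) x (e+1)] Durfee rectangles. *)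
Definition durfee (m : nat) (d : int) : fps :=
  ssum (fun e => q ^+ (e.+1 * (e + m).+1) * Th (ple d) (e + m).+1 e.+1).

(** Expand the left summand in its second bound and the right one in its first: the terms with
    difference at most d + 1 cancel, and what remains telescopes. *)
Lemma durfee_step m d :
  durfee m d = q ^+ m.+1 * Th (ple d) m.+1 0 + durfee m.+1 (d + 1).
Proof.
pose g e := q ^+ (e.+1 * (e + m).+1) * Th (ple d) (e + m).+1 e.
have hg : summable g by move=> e; apply: ordXM; nia.
apply/eqP; rewrite -subr_eq -ssumB.
rewrite (_ : _ * _ = g 0%N); last by rewrite /g mul1n add0n.
rewrite -(ssum_telescope hg); apply/eqP; apply: eq_ssum => e.
rewrite /g addnS [X in _ - _ * X]Thple_l addrK.
rewrite addSn [Th _ (e + m).+1 e.+1]Thple_r.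
rewrite (_ : (e.+1 * (e + m).+2 = e.+1 * (e + m).+1 + e.+1)%N); last by ring.
rewrite (_ : (e.+2 * (e + m).+2 = e.+1 * (e + m).+1 + e.+1 + (e + m).+2)%N);
  last by ring.
by rewrite !exprD; ring.
Qed.

Lemma rank_gf_durfee k : rank_gf k = durfee k 0.
Proof.
(* Iterating [durfee_step] from [durfee k 0] emits at stage i exactly the i-th summand of
   [rank_gf k]. *)
pose g i := durfee (k + i) i%:Z.
have hg : summable g.
  by move=> i; apply: ord_ssum => e; apply: ordXM; nia.
rewrite -[0]/(0%N%:Z) -{2}(addn0 k) -/(g 0%N) -(ssum_telescope hg).
apply: eq_ssum => i; rewrite /g durfee_step addnS Th_le_box.
by rewrite (_ : i%:Z + 1 = i.+1) ?addrK //; lia.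
Qed.

Lemma rank_gfS_durfee k : rank_gf k.+1 = durfee k (-1).
Proof. by rewrite durfee_step Th_lt0_box mulr0 add0r addNr rank_gf_durfee. Qed.

(** Generating function of the crank numbers [M(>= K+1, n)], [n > 1]. *)
Definition crank_gf (K : nat) : fps :=
  ssum (fun e => q ^+ (e.+1 * (e + K).+1) * Th pall (e + K).+1 e).

(** Both series contain the pairs with a < b and second bound e; these cancel after splitting [pall]
    at 0 and removing a largest possible part of beta on the rank side. *)
Lemma crank_sub_rank K :
  crank_gf K - rank_gf K.+1 = ssum (fun e => q ^+ (e.+1 * (e + K).+1) *
    (Th (pge 0) (e + K).+1 e - q ^+ e.+1 * Th (ple 0) (e + K).+1 e.+1)).
Proof.
rewrite rank_gfS_durfee -ssumB; apply: eq_ssum => e.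
by rewrite (Thpall_split 0) Thple_r addNr; ring.
Qed.

(** After [Th_flip], all [ple 0] terms form a telescoping series whose initial value is q^(K+1);
    only pairs with a - b = 1 survive. *)
Lemma crank_sub_rank_Th1 K :
  crank_gf K - rank_gf K.+1 = q ^+ K.+1 + ssum (fun e =>
    q ^+ (e.+1 * (e + K).+2) * Th (peq 1) (e + K) e.+1
    - q ^+ (e.+2 * (e + K).+2) * Th (peq 1) e (e + K).+2).
Proof.
rewrite crank_sub_rank.
pose g e := q ^+ (e.+1 * (e + K).+1) * Th (ple 0) (e + K) e.
have hg : summable g by move=> e; apply: ordXM; nia.
have {1}-> : q ^+ K.+1 = g 0%N.
  by rewrite /g mul1n add0n -[0]/(0%N%:Z) Th_le_box Gn0 mulr1.
rewrite -(ssum_telescope hg) -ssumD; apply: eq_ssum => e.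
rewrite -Th_flip [Th (ple 0) (e + K).+1 e.+1]Thple_l sub0r Th_lt0_step.
have h0 : Th (ple 0) (e + K) e.+1 = Th (ple 0) (e + K) e
    + q ^+ e.+1 * (Th (ple 0) (e + K) e.+1 + Th (peq 1) (e + K) e.+1).
  by rewrite {1}Thple_r (Thple_peq (0 + 1)) addrK add0r.
set Y := Th (ple 0) (e + K).+1 e.+1; set Z := Th (peq 1) e (e + K).+2.
transitivity (q ^+ (e.+1 * (e + K).+1) *
  (Th (ple 0) (e + K) e.+1 - q ^+ e.+1 * Th (ple 0) (e + K) e.+1
   - q ^+ e.+1 * (q ^+ (e + K).+1 * (q * Y + q * Z)))); first by ring.
rewrite {1}h0.
rewrite /g addSn -/Y.
have e1 : q ^+ (e.+1 * (e + K).+1) * q ^+ e.+1 = q ^+ (e.+1 * (e + K).+2).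
  by rewrite -exprD; congr (q ^+ _); ring.
have e2 : q ^+ (e.+1 * (e + K).+1) * (q ^+ e.+1 * (q ^+ (e + K).+1 * q))
    = q ^+ (e.+2 * (e + K).+2).
  by rewrite -[X in _ * (_ * (_ * X))]expr1 -!exprD; congr (q ^+ _); ring.
rewrite -e1 -e2; ring.
Qed.

(** The bracket left when the series of [crank_sub_rank_Th1] is regrouped by the power
    q^((U+2)(U+K+3)), with d = K. *)
Definition pos_term (U d : nat) : fps :=
  Th (peq 1) (U + d).+1 U.+2 - q ^+ (U + d).+3 * Th (peq 1) U.+1 (U + d).+2
  - q ^+ d * Th (peq 2) U (U + d).+2.

Lemma crank_sub_rank_pos_term K :
  crank_gf K - rank_gf K.+1 = q ^+ K.+1 + (q ^+ K.+2 * Th (peq 1) K 1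
    + ssum (fun U => q ^+ (U.+2 * (U + K).+3) * pos_term U K)).
Proof.
rewrite crank_sub_rank_Th1; congr (_ + _).
pose t e := q ^+ (e.+1 * (e + K).+2) * Th (peq 1) (e + K) e.+1.
pose s1 e := q ^+ (e.+2 * (e + K).+2) * Th (peq 1) e (e + K).+1.
pose s2 e := q ^+ (e.+3 * (e + K).+2) * Th (peq 2) e (e + K).+2.
have ht : summable t by move=> e; apply: ordXM; nia.
have hs1 : summable s1 by move=> e; apply: ordXM; nia.
transitivity (ssum t - ssum s1 - ssum s2).
  rewrite -!ssumB; apply: eq_ssum => e; rewrite /t /s1 /s2.
  rewrite [Th (peq 1) e (e + K).+2]Thpeq_r -[1 + 1]/(2 : int).
  rewrite (_ : (e.+3 * (e + K).+2 = e.+2 * (e + K).+2 + (e + K).+2)%N); last by ring.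
  rewrite exprD; ring.
(* Its alpha would need a part, yet all its parts are at most 0. Hence [s1] can be shifted by one
   index together with [t], and [s2] keeps its index. *)
have s10 : s1 0%N = 0.
  rewrite /s1 (Th_eq 1) -[RHS](mulr0 (q ^+ (2 * (0 + K).+2))); congr (_ * _).
  by rewrite -ssum0; apply: eq_ssum => b; rewrite addn1 E0S mul0r.
rewrite (ssum_recl ht) (ssum_recl hs1) s10 add0r -!addrA.
congr (_ + _); first by rewrite /t mul1n add0n.
rewrite -opprD -ssumD -ssumB; apply: eq_ssum => U; rewrite /t /s1 /s2 /pos_term.
rewrite !addSn.
rewrite (_ : (U.+3 * (U + K).+3 = U.+2 * (U + K).+3 + (U + K).+3)%N); last by ring.
rewrite (_ : (U.+3 * (U + K).+2 = U.+2 * (U + K).+3 + K)%N); last by ring.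
rewrite !exprD; ring.
Qed.

(** This reduces the second inequality to the first. The reflection and one removed part turn the
    difference into [pge (-1)] terms minus [ple (-1)] terms; telescoping the latter raises k by one
    and reproduces the bracket of [crank_sub_rank]. *)
Lemma rank_sub_crank k :
  rank_gf k - crank_gf k = q ^+ k.+1 * (crank_gf k.+1 - rank_gf k.+2 + ssum (fun e =>
    q ^+ (e.+1 * (e + k).+2) * (Th (peq (-1)) (e + k).+2 e
      + q ^+ e.+1 * Th (peq 0) (e + k).+2 e.+1))).
Proof.
rewrite crank_sub_rank -ssumD -ssumMl; last first.
  by move=> e; rewrite addnS -mulrDr; apply: ordXM; nia.
rewrite rank_gf_durfee -ssumB.
pose g e := q ^+ (e.+1 * (e + k).+1) * Th (ple (-1)) (e + k).+1 e.
have hg : summable g by move=> e; apply: ordXM; nia.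
have g0 : g 0%N = 0 by rewrite /g Th_lt0_box mulr0.
rewrite -[LHS]add0r -g0 -(ssum_telescope hg) -ssumD; apply: eq_ssum => e.
rewrite Th_flip Thpge_l (Thpall_split 0) sub0r /g addSn addnS.
rewrite (Thple_peq 0) sub0r (Thpge_peq (-1)) addNr.
have e1 : q ^+ (e.+1 * (e + k).+1) * q ^+ (e + k).+2
    = q ^+ k.+1 * q ^+ (e.+1 * (e + k).+2).
  by rewrite -!exprD; congr (q ^+ _); ring.
have e2 : q ^+ (e.+2 * (e + k).+2)
    = q ^+ k.+1 * q ^+ (e.+1 * (e + k).+2) * q ^+ e.+1.
  by rewrite -!exprD; congr (q ^+ _); ring.
rewrite e2 -mulrDr mulrA -e1; ring.
Qed.

(** * Gaussian binomials and Heine's transformation *)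

Definition qb (n k : nat) : fps := if (k <= n)%N then G (n - k) k else 0.

Lemma qb_small n k : (n < k)%N -> qb n k = 0.
Proof. by move=> nk; rewrite /qb leqNgt nk. Qed.
Lemma qbn0 n : qb n 0 = 1. Proof. by rewrite /qb Gn0. Qed.
Lemma qbnn n : qb n n = 1. Proof. by rewrite /qb leqnn subnn. Qed.
Lemma nn_qb n k : nn (qb n k).
Proof. by rewrite /qb; case: ifP => _; [exact: nn_G | exact: nn0]. Qed.
Lemma G_qb u a : G u a = qb (u + a) a.
Proof. by rewrite /qb leq_addl addnK. Qed.

Lemma qbSS n k : qb n.+1 k.+1 = qb n k + q ^+ k.+1 * qb n k.+1.
Proof.
rewrite /qb ltnS subSS; case: (ltngtP k n) => [kn|_|->]; last 2 first.
- by rewrite mulr0 addr0.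
- by rewrite subnn !G0n mulr0 addr0.
by rewrite -(subnSK kn) GSS'.
Qed.

Lemma qb_diag n k : (1 - q ^+ k.+1) * qb n.+1 k.+1 = (1 - q ^+ n.+1) * qb n k.
Proof.
rewrite /qb ltnS subSS; case: leqP => [kn|_]; last by rewrite !mulr0.
by rewrite G_ratio_r subnK.
Qed.

(** The factor q^k replaces the exponent n - k of the usual ratio, so that one formula also covers k
    >= n. *)
Lemma qb_up n k : q ^+ k * ((1 - q ^+ k.+1) * qb n k.+1) = (q ^+ k - q ^+ n) * qb n k.
Proof.
rewrite /qb; case: (ltngtP k n) => [kn|_|->]; last by rewrite !mulr0 subrr mul0r.
  rewrite G_cross subnSK // mulrA; congr (_ * _).
  by rewrite mulrBr mulr1 -exprD subnKC // ltnW.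
by rewrite !mulr0.
Qed.

Lemma qb_iq n k : (k <= n)%N -> qb n k * iq n = iq k * iq (n - k).
Proof.
elim: k n => [|k IH] n; first by rewrite qbn0 iq0 subn0 !mul1r.
case: n => // n kn; rewrite subSS; apply: (@geo_lreg k.+1) => //.
by rewrite mulrA qb_diag [RHS]mulrA iqE -IH // -mulrA mulrCA iqE.
Qed.

(** The coefficient identity of the induction step in [heine], where U = j + i. After one Pascal
    rule the difference of the sides is a multiple of [G_cross]. *)
Lemma qb_mix i j D :
  (1 - q ^+ (j + i).+1) * qb (j + i + D).+1 (j + D).+1
  = (1 - q ^+ (j + j + i + D).+2) * qb (j + i + D) (j + D).+1
    + q ^+ i * (1 - q ^+ j.+1) * qb (j + i + D) (j + D).
Proof.
case: i => [|i].
  rewrite !addn0 !qbnn qb_small //; ring.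
rewrite /qb !ifT ?subSS; try lia.
rewrite (_ : j + i.+1 + D - (j + D) = i.+1)%N; last lia.
rewrite (_ : j + i.+1 + D - (j + D).+1 = i)%N; last lia.
have := G_cross i (j + D); set k := (j + D)%N.
move=> h; rewrite GSS; set A := G i k.+1; set B := G i.+1 k.
apply/eqP; rewrite -subr_eq0.
have -> : (j + i.+1).+1 = (i.+1 + j.+1)%N by lia.
have -> : (j + j + i.+1 + D).+2 = (i.+1 + j.+1 + k.+1)%N by rewrite /k; lia.
rewrite (_ : _ - _ = - q ^+ (i.+1 + j.+1) * ((1 - q ^+ k.+1) * A - (1 - q ^+ i.+1) * B)).
  by rewrite h subrr mulr0.
rewrite !exprD; ring.
Qed.

(** [1 / ((1 - q^m) ... (1 - q^(m+N-1)))]. *)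
Definition ip (m N : nat) : fps := \prod_(i < N) geo (m + i).

Lemma ip0 m : ip m 0 = 1. Proof. by rewrite /ip big_ord0. Qed.
Lemma ipSr m N : (0 < m)%N -> (1 - q ^+ (m + N)) * ip m N.+1 = ip m N.
Proof.
by move=> m0; rewrite /ip big_ord_recr /= mulrCA geoE ?mulr1 // addn_gt0 m0.
Qed.
Lemma ip_recl m N : ip m N.+1 = geo m * ip m.+1 N.
Proof.
rewrite /ip big_ord_recl addn0; congr (_ * _).
by apply: eq_bigr => i _; rewrite addSnnS.
Qed.
Lemma ipSl m N : (0 < m)%N -> (1 - q ^+ m) * ip m N.+1 = ip m.+1 N.
Proof. by move=> m0; rewrite ip_recl mulrA geoE // mul1r. Qed.
Lemma ipD m N N' : ip m (N + N') = ip m N * ip (m + N) N'.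
Proof.
rewrite /ip big_split_ord; congr (_ * _).
by apply: eq_bigr => i _ /=; rewrite addnA.
Qed.
Lemma nn_ip m N : nn (ip m N).
Proof. by apply: nn_prod => i _; exact: nn_geo. Qed.
Lemma iq_ip n : iq n = ip 1 n.
Proof.
elim: n => [|n IH]; first by rewrite iq0 ip0.
by rewrite iqS IH /ip big_ord_recr.
Qed.

Lemma summable_qX (e : nat -> nat) (f : nat -> fps) :
  (forall i, (i <= e i)%N) -> summable (fun i => q ^+ e i * f i).
Proof. by move=> h i; apply: ordXM. Qed.

(** The q-binomial theorem at x = q^m: by [GSS'], multiplying by 1 - q^m replaces (w+1, m) by (w,
    m+1). *)
Lemma ssum_G w m : (0 < m)%N -> ssum (fun b => q ^+ (m * b) * G w b) = ip m w.+1.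
Proof.
have hs x k : (0 < k)%N -> summable (fun b => q ^+ (k * b) * G x b).
  by move=> k0; apply: summable_qX => i; nia.
elim: w m => [|w IH] m m0; apply: (@geo_lreg m) => //.
  rewrite ipSl // ip0 -ssumMl; last exact: hs.
  transitivity (q ^+ (m * 0)); last by rewrite muln0.
  rewrite -(@ssum_telescope (fun b => q ^+ (m * b))); last first.
    by move=> i; apply: ordX; nia.
  by apply: eq_ssum => b; rewrite G0n mulnS exprD; ring.
rewrite ipSl // -(IH m.+1) // mulrBl mul1r {1}ssum_recl; last exact: hs.
rewrite [in RHS]ssum_recl; last exact: hs.
rewrite -ssumMl; last exact: hs.
rewrite -addrA -ssumB !muln0 !Gn0; congr (_ + _); apply: eq_ssum => b.
by rewrite GSS' mulSn mulnS !exprD; ring.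
Qed.

(** Heine's transformation in terminating form, by induction on U for all m at once: multiplied by 1
    - q^(U+1), each side at U + 1 becomes a combination of the values at (U, m) and (U, m+1). *)
Lemma heine D w U m : (D <= w)%N -> (0 < m)%N ->
  ssum (fun b => q ^+ (m * b) * (G U (b + D) * G w b))
  = ip m (U + w).+1 * ssum (fun j => q ^+ (m * j + j * (j + D)) *
      (qb (U + D) (j + D) * qb (w - D) j)).
Proof.
move=> Dw; elim: U m => [|U IH] m m0.
  rewrite [X in _ = _ * X](@ssum_single _ 0) ?muln0 ?mul0n ?addn0 ?add0n; first last.
  - move=> i i0; rewrite [qb D _]qb_small ?mul0r ?mulr0 //; lia.
  - by [].
  rewrite qbnn qbn0 !mulr1 -ssum_G //.
  by apply: eq_ssum => b; rewrite G0n mul1r.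
pose c x j := q ^+ (j * (j + D)) * (qb (x + D) (j + D) * qb (w - D) j).
have hs x k : (0 < k)%N -> summable (fun j => q ^+ (k * j) * c x j).
  by move=> k0; apply: summable_qX => i; nia.
have hs2 x k : (0 < k)%N ->
    summable (fun b => q ^+ (k * b) * (G x (b + D) * G w b)).
  by move=> k0; apply: summable_qX => i; nia.
have eqc x k : ssum (fun j => q ^+ (k * j + j * (j + D)) *
    (qb (x + D) (j + D) * qb (w - D) j)) = ssum (fun j => q ^+ (k * j) * c x j).
  by apply: eq_ssum => j; rewrite /c exprD -mulrA.
apply: (@geo_lreg U.+1) => //.
transitivity (ssum (fun b => q ^+ (m * b) * (G U (b + D) * G w b))
  - q ^+ (U + D).+1 * ssum (fun b => q ^+ (m.+1 * b) * (G U (b + D) * G w b))).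
  rewrite -!ssumMl ?hs2 // -?ssumB; try exact: hs2.
  apply: eq_ssum => b.
  rewrite mulrCA [X in _ * X]mulrA G_ratio_l.
  rewrite (_ : (U + (b + D)).+1 = b + (U + D).+1)%N; last by lia.
  by rewrite mulSn !exprD; ring.
rewrite !IH // !eqc addSn -(@ipSr m (U + w).+1) // -(@ipSl m (U + w).+1) //.
transitivity (ip m (U + w).+2 * ((1 - q ^+ (m + (U + w).+1)) *
    ssum (fun j => q ^+ (m * j) * c U j)
  - (1 - q ^+ m) * q ^+ (U + D).+1 * ssum (fun j => q ^+ (m.+1 * j) * c U j))).
  ring.
rewrite mulrCA; congr (_ * _).
rewrite -!ssumMl ?hs // -?ssumB; try exact: hs.
(* The summand is split by its explicit factor q^m: [h j] has one more q^m and is matched with index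
   j + 1 of the target, together with [g j.+1]. *)
pose g j := q ^+ (m * j) * c U j * (1 - q ^+ (U + D + j).+1).
pose h j := q ^+ m * (q ^+ (m * j) * c U j * (q ^+ (U + D + j).+1 - q ^+ (U + w).+1)).
have hg : summable g by move=> j; apply: ordMl; exact: hs.
have hh : summable h by move=> j; apply: ordM; apply: ordMl; exact: hs.
transitivity (ssum g + ssum h).
  rewrite -ssumD; apply: eq_ssum => j; rewrite /g /h.
  rewrite mulSn 2!exprD.
  by rewrite (_ : (U + D + j).+1 = j + (U + D).+1)%N ?exprD; [ring | lia].
rewrite (ssum_recl hg) [in RHS]ssum_recl; last first.
  by move=> j; apply: ordM; exact: hs.
rewrite -addrA -ssumD; congr (_ + _).
  rewrite /g /c !muln0 !mul0n !add0n !expr0 !mul1r !qbn0 !mulr1 !addn0.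
  by rewrite -!G_qb G_ratio_l mulrC.
apply: eq_ssum => j; rewrite /g /h /c.
case: (leqP j U) => [jU|Uj]; last first.
  rewrite !(@qb_small (U + D)) ?(@qb_small (U.+1 + D)); [ring|lia|lia|lia].
rewrite -(subnKC jU); move: (U - j)%N => i {IH hs hs2 eqc g h hg hh jU}.
rewrite !addSn [RHS]mulrCA [X in _ = _ * X]mulrCA.
rewrite [X in _ = _ * (_ * X)]mulrA qb_mix.
have := qb_up (w - D) j.
move=> hu; rewrite [X in _ = _ * (_ * X)]mulrDl [X in _ = _ * X]mulrDr [RHS]mulrDr; congr (_ + _).
  by rewrite (_ : (j + i + D + j.+1).+1 = (j + j + i + D).+2)%N; [ring | lia].
symmetry; transitivity (q ^+ (m * j.+1 + (j.+1 * (j + D).+1 + i)) * qb (j + i + D) (j + D)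
   * ((1 - q ^+ j.+1) * qb (w - D) j.+1)); first by rewrite !exprD; ring.
rewrite (_ : m * j.+1 + (j.+1 * (j + D).+1 + i)
  = (m + m * j + j * (j + D) + (j + i + D).+1) + j)%N; last by ring.
rewrite exprD -!mulrA (mulrCA (q ^+ j)) hu.
have e : q ^+ (j + i + D).+1 * (q ^+ j - q ^+ (w - D))
    = q ^+ (j + i + D + j).+1 - q ^+ (j + i + w).+1.
  by rewrite mulrBr -!exprD; congr (q ^+ _ - q ^+ _); lia.
rewrite -e !exprD; ring.
Qed.

Lemma Th1_heine U w : (0 < w)%N ->
  Th (peq 1) U.+1 w.+1 = ip 2 (U + w).+1 * ssum (fun j =>
     q ^+ (j * j + 3 * j).+1 * (qb U.+1 j.+1 * qb (w - 1) j)).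
Proof.
move=> w0; rewrite (Th_eq 1).
transitivity (q * ssum (fun b => q ^+ (2 * b) * (G U (b + 1) * G w b))).
  rewrite -ssumMl; last by apply: summable_qX => b; lia.
  by apply: eq_ssum => b; rewrite !ES (_ : 2 * b = b + b)%N ?exprD; [ring|lia].
rewrite heine // mulrCA; congr (_ * _).
rewrite -ssumMl; last by apply: summable_qX => b; nia.
apply: eq_ssum => j; rewrite !addn1 mulrA -exprS; congr (q ^+ _ * _); ring.
Qed.

Lemma Th2_heine U w : (1 < w)%N ->
  Th (peq 2) U.+1 w.+1 = ip 2 (U + w).+1 * ssum (fun j =>
     q ^+ (j * j + 4 * j).+2 * (qb U.+2 j.+2 * qb (w - 2) j)).
Proof.
move=> w0; rewrite (Th_eq 2).
transitivity (q ^+ 2 * ssum (fun b => q ^+ (2 * b) * (G U (b + 2) * G w b))).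
  rewrite -ssumMl; last by apply: summable_qX => b; lia.
  by apply: eq_ssum => b; rewrite !ES (_ : 2 * b = b + b)%N ?exprD; [ring|lia].
rewrite heine // mulrCA; congr (_ * _).
rewrite -ssumMl; last by apply: summable_qX => b; nia.
apply: eq_ssum => j; rewrite !addn2 mulrA -exprD; congr (q ^+ _ * _); ring.
Qed.

(** * Positivity of [pos_term] *)

(** The binomial with lower index j - 1, made 0 at j = 0 so that Pascal's rule and the ratio hold
    there too. *)
Definition qbp (n j : nat) : fps := if j is j'.+1 then qb n j' else 0.

Lemma nn_qbp n j : nn (qbp n j).
Proof. by case: j => [|j]; [exact: nn0 | exact: nn_qb]. Qed.

Lemma qbp_qb n j : qb n.+1 j = qbp n j + q ^+ j * qb n j.
Proof. by case: j => [|j]; rewrite ?qbSS // !qbn0 add0r mul1r. Qed.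

Lemma qbp_up n j : q ^+ j * (1 - q ^+ j) * qb n j = (q ^+ j - q ^+ n.+1) * qbp n j.
Proof.
case: j => [|j]; first by rewrite /=; ring.
by rewrite -mulrA exprS -[LHS]mulrA -exprS qb_up /= !exprS; ring.
Qed.

(** The numerators of [phi_term_sum] come from Heine's transformation: subtracting
    [1 + q ^ u] times a telescoping series makes the summands positive. *)
Definition phi_c (u j : nat) : fps :=
  q ^+ j - q ^+ (j + 3) + q ^+ u + q ^+ u.+1 + q ^+ u.+2 - q ^+ (u + j + 3)
  + q ^+ (2 * u).+2.
Definition phi_h (s j : nat) : fps := 1 + q + q ^+ 2 - q ^+ s - q ^+ j.+1.

Definition phi_term (u s n j : nat) : fps :=
  qb u j.+1 * (q ^+ (j * j + 4 * j).+1 * phi_c u j * qb n j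
    + q ^+ (j * j + 3 * j + u) * phi_h s j * qbp n j).

Lemma phi_term_sum (u n s : nat) : (n.+2 = u + s)%N ->
  ssum (fun j => q ^+ (j * j + 3 * j).+1 * (qb u j.+1 * qb n.+1 j))
    * (1 + q ^+ u - q ^+ u.+2)
  - ssum (fun j => q ^+ (j * j + 4 * j).+2 * (qb u.+1 j.+2 * qb n j))
  = (1 - q) * ssum (phi_term u s n).
Proof.
move=> ns.
pose A j := q ^+ (j * j + 4 * j) * (qb u j.+1 * qb n j).
pose B j := q ^+ (j * j + 3 * j) * (qb u j.+1 * qbp n j).
have hA : summable A by apply: summable_qX => j; nia.
have hB : summable B by apply: summable_qX => j; nia.
have -> : ssum (fun j => q ^+ (j * j + 3 * j).+1 * (qb u j.+1 * qb n.+1 j))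
    = q * (ssum A + ssum B).
  rewrite -ssumD -ssumMl; last by move=> j; apply: ordD.
  apply: eq_ssum => j; rewrite /A /B qbp_qb.
  by rewrite (_ : j * j + 4 * j = j * j + 3 * j + j)%N ?exprS ?exprD; [ring|lia].
have -> : ssum (fun j => q ^+ (j * j + 4 * j).+2 * (qb u.+1 j.+2 * qb n j))
    = q ^+ 2 * ssum A + ssum B.
  rewrite (ssum_recl hB) /B /= !mulr0 add0r -ssumMl // -ssumD.
  apply: eq_ssum => j; rewrite /A qbSS.
  rewrite (_ : j.+1 * j.+1 + 3 * j.+1 = (j * j + 4 * j).+2 + j.+2)%N; last by lia.
  by rewrite [in RHS]exprD -[(j * j + 4 * j).+2]addn2 !exprD; ring.
(* As [g 0] is 0, the telescoping series is 0. Added with weight (1 - q)(1 + q^u), it cancels the -1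
   in q^(u+1) + q^(u+2) - 1, the coefficient of [ssum B] divided by 1 - q. *)
pose g j := q ^+ (j * j + 3 * j) * ((1 - q ^+ j.+1) * qb u j.+1 * qbp n j).
have hg : summable g by apply: summable_qX => j; nia.
have tg := ssum_telescope hg.
have g0 : g 0%N = 0 by rewrite /g /= !mulr0.
rewrite g0 in tg.
transitivity (q * (ssum A + ssum B) * (1 + q ^+ u - q ^+ u.+2)
   - (q ^+ 2 * ssum A + ssum B)
   + (1 - q) * (1 + q ^+ u) * ssum (fun j => g j - g j.+1)).
  by rewrite tg mulr0 addr0.
have hp : summable (phi_term u s n).
  move=> j; rewrite /phi_term; apply: ordM.
  by apply: ordD; rewrite -mulrA; apply: ordXM; nia.
transitivity ((q * (1 + q ^+ u - q ^+ u.+2) - q ^+ 2) * ssum A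
   + (q * (1 + q ^+ u - q ^+ u.+2) - 1) * ssum B
   + (1 - q) * (1 + q ^+ u) * ssum (fun j => g j - g j.+1)); first by ring.
rewrite -!ssumMl //; last first.
  move=> j; apply: ordB => //; apply: (@ord_le _ j.+1) => //; exact: hg.
rewrite -!ssumD; apply: eq_ssum => j.
have -> : g j.+1 = q ^+ (j * j + 4 * j + 3) * ((q ^+ j.+1 - q ^+ u) * qb u j.+1 * qb n j).
  rewrite -qb_up /g /= (_ : j.+1 * j.+1 + 3 * j.+1 = j * j + 4 * j + 3 + j.+1)%N;
    last by lia.
  by rewrite exprD; ring.
rewrite /A /B /g /phi_term /phi_c /phi_h.
(* Trades -q^(j+1) on [qbp n j] for -q^(u+s) and a multiple of [qb n j]; then q^u factors out and
   leaves [phi_h]. *)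
have hq : q * (q ^+ j * (1 - q ^+ j) * qb n j) = (q * q ^+ j - q ^+ (u + s)) * qbp n j.
  by rewrite qbp_up -ns (exprS q n.+1); ring.
have e4 : (j * j + 4 * j = j * j + 3 * j + j)%N by lia.
have euj : (2 * u).+2 = (u + u + 2)%N by lia.
rewrite e4 euj -![u.+2]addn2 -![u.+1]addn1.
move: (j * j + 3 * j)%N => k {e4 euj tg g0 hg hp hA hB}.
set V := qb n j in hq *; set W := qbp n j in hq *; set Z := qb u _.
apply/eqP; rewrite -subr_eq0; apply/eqP.
transitivity ((1 - q) * Z * q ^+ k * (q * (q ^+ j * (1 - q ^+ j) * V)
  - (q * q ^+ j - q ^+ (u + s)) * W)); last by rewrite hq subrr mulr0.
rewrite !(exprS, exprD); ring.
Qed.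

(** * Cancelling numerator factors against the denominator *)

Definition nn_mul1B (k : nat) (A : fps) := nn ((1 - q ^+ k) * A).

Lemma nn_qXM m a : nn a -> nn (q ^+ m * a).
Proof. by move=> ha; apply: nnM => //; apply: nnX; exact: nnq. Qed.

Lemma nn_mul1B_dvd d k A : (d %| k)%N -> nn_mul1B d A -> nn A -> nn_mul1B k A.
Proof.
move=> /dvdnP [t ->] h hA; elim: t => [|t IH].
  by rewrite /nn_mul1B mul0n expr0 subrr mul0r.
rewrite /nn_mul1B (_ : _ * A = (1 - q ^+ d) * A + q ^+ d * ((1 - q ^+ (t * d)) * A)).
  by apply: nnD => //; exact: nn_qXM.
by rewrite mulSn exprD; ring.
Qed.

Lemma nn_mul1B_ip k m N : (0 < m)%N -> (m <= k < m + N)%N -> nn_mul1B k (ip m N).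
Proof.
move=> m0 /andP [mk kN].
have -> : N = (k - m + (m + N - k.+1).+1)%N by lia.
rewrite /nn_mul1B ipD mulrCA subnKC // ipSl; last by lia.
by apply: nnM; exact: nn_ip.
Qed.

Lemma nn_mul1B_Ml k A B : nn_mul1B k A -> nn B -> nn_mul1B k (A * B).
Proof. by move=> hA hB; rewrite /nn_mul1B mulrA; exact: nnM. Qed.
Lemma nn_mul1B_Mr k A B : nn A -> nn_mul1B k B -> nn_mul1B k (A * B).
Proof. by move=> hA hB; rewrite mulrC; exact: nn_mul1B_Ml. Qed.

Ltac nn_tac :=
  repeat match goal with
  | |- nn (_ + _) => apply: nnD
  | |- nn (q ^+ _ * _) => apply: nn_qXM
  | |- nn (q * _) => apply: nnM; [exact: nnq|]
  end => //.

(** The numerator of the binomial cancels the first a + b + 1 factors of the denominator, and its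
    own denominator supplies the exponents 2..a+1 and 2..b+1. *)
Lemma qb_ip a b N :
  (1 - q) * qb (a + b).+2 a.+1 * ip 2 ((a + b).+1 + N)
  = ip 2 a * ip 2 b * ip (a + b).+3 N.
Proof.
have iqS' n : iq n.+1 = geo 1 * ip 2 n by rewrite iq_ip ip_recl.
have h : qb (a + b).+2 a.+1 * (geo 1 * ip 2 (a + b).+1)
    = (geo 1 * ip 2 a) * (geo 1 * ip 2 b).
  rewrite -!iqS' qb_iq; last by lia.
  by congr (_ * iq _); lia.
rewrite ipD !add2n mulrA; congr (_ * _).
apply: (@geo_lreg 1) => //; rewrite expr1.
have g1 : (1 - q) * geo 1 = 1 by rewrite -{1}(expr1 q) geoE.
transitivity ((1 - q) * (1 - q) * ((1 - q) * (qb (a + b).+2 a.+1 * (geo 1 * ip 2 (a + b).+1)))).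
  rewrite -[LHS]mul1r -[X in X * _ = _]g1; ring.
rewrite h.
transitivity (((1 - q) * geo 1) * ((1 - q) * geo 1) * ((1 - q) * (ip 2 a * ip 2 b))).
  ring.
by rewrite g1 !mul1r.
Qed.

Lemma nn_phi_c3 u j A : nn A -> nn_mul1B 3 A -> nn_mul1B j.+1 A \/ j = 0%N ->
  nn (phi_c u j * A).
Proof.
move=> hA h3 [hj|->].
  rewrite (_ : _ * A = q ^+ j * ((1 - q ^+ 3) * A) + q ^+ u * A + q ^+ u.+1 * A
    + q ^+ u.+2 * ((1 - q ^+ j.+1) * A) + q ^+ (2 * u).+2 * A); first nn_tac.
  by rewrite /phi_c; qring.
rewrite (_ : _ * A = (1 - q ^+ 3) * A + q ^+ u * ((1 - q ^+ 3) * A) + q ^+ u.+1 * A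
    + q ^+ u.+2 * A + q ^+ (2 * u).+2 * A); first nn_tac.
by rewrite /phi_c; qring.
Qed.

(** This and the next two lemmas cover the small cases in which 3 is not an exponent of the
    denominator: -q^(j+3) cancels against a positive term, and 1 - q^2 absorbs the other negative
    power. *)
Lemma nn_phi_c30 A : nn A -> nn_mul1B 2 A -> nn (phi_c 3 0 * A).
Proof.
move=> hA h2; rewrite (_ : _ * A = A + q ^+ 4 * ((1 - q ^+ 2) * A) + q ^+ 5 * A
  + q ^+ 8 * A); first nn_tac.
by rewrite /phi_c; qring.
Qed.
Lemma nn_phi_c31 A : nn A -> nn_mul1B 2 A -> nn (phi_c 3 1 * A).
Proof.
move=> hA h2; rewrite (_ : _ * A = q * A + q ^+ 3 * A + q ^+ 5 * ((1 - q ^+ 2) * A)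
  + q ^+ 8 * A); first nn_tac.
by rewrite /phi_c; qring.
Qed.
Lemma nn_phi_c41 A : nn A -> nn_mul1B 2 A -> nn (phi_c 4 1 * A).
Proof.
move=> hA h2; rewrite (_ : _ * A = q * A + q ^+ 5 * A + q ^+ 6 * ((1 - q ^+ 2) * A)
  + q ^+ 10 * A); first nn_tac.
by rewrite /phi_c; qring.
Qed.

(** Pair q^s with whichever of q and q^2 has an exponent of the same parity; the quotient is
    divisible by 1 - q^2. *)
Lemma nn_two_sub s A : (0 < s)%N -> nn A -> nn_mul1B 2 A -> nn ((q + q ^+ 2 - q ^+ s) * A).
Proof.
move=> s0 hA h2; have hk k : ~~ odd k -> nn_mul1B k A.
  by move=> hk; apply: (@nn_mul1B_dvd 2) => //; rewrite dvdn2.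
case: (boolP (odd s)) => os.
  have := hk (s - 1)%N; rewrite oddB // os => /(_ isT) h.
  rewrite (_ : _ * A = q ^+ 2 * A + q * ((1 - q ^+ (s - 1)) * A)); first nn_tac.
  by rewrite -{1}(subnK s0) exprD; ring.
have s2 : (1 < s)%N by case: s os s0 => [|[]].
have := hk (s - 2)%N; rewrite oddB // (negbTE os) => /(_ isT) h.
rewrite (_ : _ * A = q * A + q ^+ 2 * ((1 - q ^+ (s - 2)) * A)); first nn_tac.
by rewrite -{1}(subnK s2) exprD; ring.
Qed.

Lemma nn_phi_h s j A : (0 < j)%N -> nn A -> nn_mul1B 2 A -> nn_mul1B j A \/ j = 1%N ->
  nn_mul1B j.+1 A -> nn (phi_h s j * A).
Proof.
move=> j0 hA h2 hj hj1; rewrite /phi_h; case: (posnP s) => [->|s0].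
  case: hj => [hj|->].
    rewrite (_ : _ * A = q ^+ 2 * A + q * ((1 - q ^+ j) * A)); first nn_tac.
    by qring.
  by rewrite (_ : _ * A = q * A); [nn_tac | ring].
rewrite (_ : _ * A = (1 - q ^+ j.+1) * A + (q + q ^+ 2 - q ^+ s) * A); last ring.
by apply: nnD => //; exact: nn_two_sub.
Qed.

(** By [qb_ip], the weight of the summand j = a of the phi series with u = a + b + 2. *)
Definition weight (a b N : nat) := ip 2 a * ip 2 b * ip (a + b).+3 N.
Lemma nn_weight a b N : nn (weight a b N).
Proof. by do 2?apply: nnM; exact: nn_ip. Qed.
Lemma nn_mul1B_weight a b N k :
  [|| (2 <= k < 2 + a)%N, (2 <= k < 2 + b)%N | ((a + b).+3 <= k < (a + b).+3 + N)%N] ->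
  nn_mul1B k (weight a b N).
Proof.
rewrite /weight; case/or3P => h.
- apply: nn_mul1B_Ml; last exact: nn_ip.
  by apply: nn_mul1B_Ml; [exact: nn_mul1B_ip | exact: nn_ip].
- apply: nn_mul1B_Ml; last exact: nn_ip.
  by apply: nn_mul1B_Mr; [exact: nn_ip | exact: nn_mul1B_ip].
- by apply: nn_mul1B_Mr; [apply: nnM; exact: nn_ip | exact: nn_mul1B_ip].
Qed.

Lemma nn_phi_c_weight a b N : (0 < N)%N -> nn (phi_c (a + b).+2 a * weight a b N).
Proof.
move=> N0; have hn := nn_weight a b N.
have h3 : nn_mul1B 3 (weight a b N) -> nn (phi_c (a + b).+2 a * weight a b N).
  move=> h3; apply: nn_phi_c3 => //; case: a {hn h3} => [|a]; [by right | left].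
  by apply: nn_mul1B_weight; lia.
(* Exactly then is 3 an exponent of the denominator: in the first or second block, or as the start a
   + b + 3 of the third. *)
case: (boolP [|| (1 < a)%N, (1 < b)%N | (a + b == 0)%N]) => hab.
  by apply: h3; apply: nn_mul1B_weight; lia.
have [[-> ->]|[[-> ->]|[-> ->]]] :
    (a = 0 /\ b = 1 \/ a = 1 /\ b = 0 \/ a = 1 /\ b = 1)%N by lia.
- by apply: nn_phi_c30; [exact: nn_weight | apply: nn_mul1B_weight].
- by apply: nn_phi_c31; [exact: nn_weight | apply: nn_mul1B_weight].
- by apply: nn_phi_c41; [exact: nn_weight | apply: nn_mul1B_weight].
Qed.

Lemma nn_phi_h_weight s a b N : (0 < a)%N -> nn (phi_h s a * weight a b N).
Proof.
move=> a0; apply: nn_phi_h => //; try by [exact: nn_weight | apply: nn_mul1B_weight; lia].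
case: a a0 => [|[|a]] // _; [by right | left; apply: nn_mul1B_weight; lia].
Qed.

Lemma phi_term_weight s n a b N :
  (1 - q) * ip 2 ((a + b).+1 + N) * phi_term (a + b).+2 s n a
  = q ^+ (a * a + 4 * a).+1 * (phi_c (a + b).+2 a * weight a b N * qb n a)
  + q ^+ (a * a + 3 * a + (a + b).+2) * (phi_h s a * weight a b N * qbp n a).
Proof. by rewrite /weight -qb_ip /phi_term; ring. Qed.

Lemma nn_phi_term_weight s n a b N : (0 < N)%N ->
  nn ((1 - q) * ip 2 ((a + b).+1 + N) * phi_term (a + b).+2 s n a).
Proof.
move=> N0; rewrite phi_term_weight; apply: nnD; apply: nn_qXM.
  by apply: nnM; [exact: nn_phi_c_weight | exact: nn_qb].
case: a => [|a]; first by rewrite mulr0; exact: nn0.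
by apply: nnM; [exact: nn_phi_h_weight | exact: nn_qbp].
Qed.

Lemma phi_c_last u : (1 - q) * phi_c u.+1 u = q ^+ u * (1 - q ^+ 3).
Proof.
by rewrite /phi_c (_ : 2 * u.+1 = u + u + 2)%N; [qring | lia].
Qed.

Lemma qb_n1 n : (1 - q) * qb n 1 = 1 - q ^+ n.
Proof.
case: n => [|n]; first by rewrite qb_small // mulr0 expr0 subrr.
by rewrite -{1}(expr1 q) qb_diag qbn0 mulr1.
Qed.

(** At j = u - 1 the first binomial is 1 and cannot absorb 1 - q. Instead [phi_c_last] absorbs it in
    the first part and the binomial [qbp] in the second; for U = 0 both parts are combined by
    hand. *)
Lemma nn_phi_term_last U s M : (0 < s)%N -> M = (U.+1 + (U + s).+3)%N ->
  nn ((1 - q) * ip 2 M * phi_term U.+2 s (U + s) U.+1).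
Proof.
move=> s0 ->; have hK := nn_ip 2 (U.+1 + (U + s).+3).
rewrite /phi_term qbnn mul1r /=.
case: U hK => [|U] hK.
  rewrite !add0n qbn0 mulr1.
  rewrite [X in nn X](_ : _ = q ^+ 6 * (((q + q ^+ 2 + q ^+ 3) * ((1 - q) * qb s 1)
      + (1 - q) * (1 + q - q ^+ s)) * ip 2 (1 + s.+3))); last first.
    by rewrite /phi_c /phi_h; qring.
  rewrite qb_n1; apply: nn_qXM; set K := ip 2 _.
  have hs k : (k < s + 6)%N -> (2 <= k)%N -> nn_mul1B k K by move=> *; apply: nn_mul1B_ip; lia.
  case: (ltngtP s 1) => [|s2|->]; first by lia.
    rewrite [X in nn X](_ : _ = (1 - q ^+ s) * K + q * ((1 - q ^+ s.+1) * K)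
       + q ^+ 3 * ((1 - q ^+ s) * K)); last by qring.
    nn_tac; apply: hs; lia.
  by rewrite [X in nn X](_ : _ = (1 - q ^+ 4) * K); [apply: hs; lia | ring].
rewrite mulrDr; apply: nnD.
  rewrite [X in nn X](_ : _ = q ^+ (U.+2 * U.+2 + 4 * U.+2).+1 *
    (((1 - q) * phi_c U.+3 U.+2) * ip 2 (U.+2 + (U.+1 + s).+3) * qb (U.+1 + s) U.+2));
    last ring.
  apply: nn_qXM; apply: nnM; last exact: nn_qb.
  by rewrite phi_c_last -mulrA; apply: nn_qXM; apply: nn_mul1B_ip; lia.
case: s s0 hK => // s _ hK.
rewrite [X in nn X](_ : _ = q ^+ (U.+2 * U.+2 + 3 * U.+2 + U.+3) * (phi_h s.+1 U.+2 *
   ((1 - q) * qb (U + s).+2 U.+1 * ip 2 ((U + s).+1 + U.+3.+3)))); last first.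
  rewrite (_ : U.+2 + (U.+1 + s.+1).+3 = (U + s).+1 + U.+3.+3)%N; last lia.
  by rewrite (_ : U.+1 + s.+1 = (U + s).+2)%N; [ring | lia].
rewrite qb_ip -/(weight U s _); apply: nn_qXM; set L := weight _ _ _.
have hL : nn L by exact: nn_weight.
case: s {hK} @L hL => [|s] L hL; rewrite /phi_h.
  rewrite [X in nn X](_ : _ = (1 - q ^+ U.+3) * L + q ^+ 2 * L); last by ring.
  by nn_tac; apply: nn_mul1B_weight; lia.
rewrite [X in nn X](_ : _ = (1 - q ^+ s.+2) * L + (q + q ^+ 2 - q ^+ U.+3) * L); last by ring.
by apply: nnD; [|apply: nn_two_sub => //]; apply: nn_mul1B_weight; lia.
Qed.

(** For s = 0 the last term has only the trivial binomial 1 beside 1 - q, so it is added to the term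
    before it. *)
Lemma nn_phi_term_s0 U M : M = (U.+1 + U.+3)%N ->
  nn ((1 - q) * ip 2 M * (phi_term U.+2 0 U U + phi_term U.+2 0 U U.+1)).
Proof.
move=> ->; have hK := nn_ip 2 (U.+1 + U.+3).
case: U hK => [|U] hK.
  set K := ip 2 _ in hK *.
  have h2 : nn_mul1B 2 K by apply: nn_mul1B_ip.
  have h5 : nn_mul1B 5 K by apply: nn_mul1B_ip.
  rewrite /phi_term /= qbn0 qbnn (@qb_small 0 1) // !mulr0 !mulr1 add0r.
  rewrite [X in nn X](_ : _ = q * K * ((1 - q) * qb 2 1 * phi_c 2 0
     + q ^+ 5 * ((1 - q) * phi_h 0 1))); last by qring.
  rewrite qb_n1 [X in nn X](_ : _ = q * ((1 - q ^+ 5) * K) + q ^+ 7 * ((1 - q ^+ 2) * K)).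
    by nn_tac.
  by rewrite /phi_c /phi_h; qring.
set K := ip 2 _ in hK *.
have cK k : (2 <= k <= U + U + 7)%N -> nn_mul1B k K by move=> hk; apply: nn_mul1B_ip; lia.
have hlo := phi_term_weight 0 U.+1 U.+1 0 U.+4.
rewrite !addn0 in hlo.
rewrite mulrDr hlo.
(* Brings both terms over the full denominator [K], using (1 - q) [U+3, U+2] = 1 - q^(U+3). *)
have hL : weight U.+1 0 U.+4 = (1 - q ^+ U.+3) * K.
  rewrite /weight -qb_ip addn0; congr (_ * _).
  by rewrite -[U.+3]addn1 addnC -G_qb -[1 - q]/(1 - q ^+ 1) -G_cross G0n mulr1.
set L := weight _ _ _ in hL *.
have nnL : nn L by exact: nn_weight.
have cL : nn_mul1B U.+2 L by apply: nn_mul1B_weight; lia.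
have hh : nn (phi_h 0 U.+1 * L) by exact: nn_phi_h_weight.
have hr : (1 - q) * K * phi_term U.+3 0 U.+1 U.+2
    = q ^+ (U.+1 * U.+1 + 4 * U.+1).+1 * (q ^+ (2 * U + 7)
       * ((1 - q) * (q + q ^+ 2 - q ^+ U.+3) * K)).
  rewrite /phi_term /= !qbnn (@qb_small U.+1) // mulr0 add0r mulr1 mul1r.
  rewrite (_ : U.+2 * U.+2 + 3 * U.+2 + U.+3
     = (U.+1 * U.+1 + 4 * U.+1).+1 + (2 * U + 7))%N; last by lia.
  by rewrite /phi_h exprD; ring.
rewrite hr qbnn mulr1.
rewrite [X in nn X](_ : _ = q ^+ (U.+1 * U.+1 + 4 * U.+1).+1 *
  (q ^+ U.+1 * L + q ^+ U.+3 * L + q ^+ (U + 5) * ((1 - q ^+ U.+2) * L)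
   + q ^+ (2 * U + 8) * ((1 - q ^+ 2) * K + (1 - q ^+ U.+2) * K))
  + q ^+ (U.+1 * U.+1 + 3 * U.+1 + U.+3) * (phi_h 0 U.+1 * L * qbp U.+1 U.+1)).
  nn_tac; try by apply: cK; lia.
  by apply: nnM => //; exact: nn_qbp.
rewrite [LHS]addrAC; congr (_ + _); rewrite -mulrDr; congr (_ * _).
rewrite /phi_c hL (_ : (2 * U.+3).+2 = U + U + 8)%N; last by lia.
rewrite (_ : 2 * U + 7 = U + U + 7)%N; last by lia.
rewrite (_ : 2 * U + 8 = U + U + 8)%N; last by lia.
by qring.
Qed.

Lemma ssum_fin f B : summable f -> (forall j, (B <= j)%N -> f j = 0) ->
  ssum f = \sum_(j < B) f j.
Proof.
move=> hf h; apply: fpsP => n; rewrite (@co_ssum _ (B + n.+1)) ?co_sum //; last by lia.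
rewrite big_split_ord /= [X in _ + X]big1 ?addr0 // => i _.
by rewrite h //= leq_addr.
Qed.

Lemma nn_phi_sum U s :
  nn (ip 2 (U.+1 + (U + s).+3) * ((1 - q) * ssum (phi_term U.+2 s (U + s)))).
Proof.
have hs : summable (phi_term U.+2 s (U + s)).
  by move=> j; apply: ordM; apply: ordD; rewrite -mulrA; apply: ordXM; nia.
rewrite (@ssum_fin _ U.+2 hs); last first.
  by move=> j hj; rewrite /phi_term qb_small ?mul0r.
rewrite mulrA [_ * (1 - q)]mulrC !big_ord_recr /= -addrA mulrDr mulr_sumr.
apply: nnD.
  apply: nn_sum => j _; have hj := ltn_ord j.
  have := @nn_phi_term_weight s (U + s) j (U - j) (U + s).+3 isT.
  by rewrite subnKC // ltnW.
case: s hs => [|s] hs; first by rewrite addn0; exact: nn_phi_term_s0.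
rewrite mulrDr; apply: nnD; last exact: nn_phi_term_last.
have := @nn_phi_term_weight s.+1 (U + s.+1) U 0 (U + s.+1).+3 isT.
by rewrite addn0.
Qed.

(** Holds term by term: the ratio of corresponding summands does not depend on b. *)
Lemma Th1_ratio U d :
  (1 - q ^+ U.+1) * Th (peq 1) (U + d).+1 U.+2
  = (1 - q ^+ (U + d).+1) * Th (peq 1) U.+1 (U + d).+2.
Proof.
rewrite !(Th_eq 1) -!ssumMl; try by move=> b; apply: ordM; exact: ord_E.
apply: eq_ssum => b; rewrite addn1 !ES; apply: (@geo_lreg b.+1) => //.
have h1 := G_ratio_l U b; have h2 := G_ratio_l (U + d) b.
have h3 := G_ratio_r (U + d) b; have h4 := G_ratio_r U b.
transitivity (q ^+ b.+1 * q ^+ b * ((1 - q ^+ U.+1) * G U.+1 b)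
  * ((1 - q ^+ b.+1) * G (U + d) b.+1)); first by ring.
rewrite h1 h3.
transitivity (q ^+ b.+1 * q ^+ b * ((1 - q ^+ (U + d).+1) * G (U + d).+1 b)
  * ((1 - q ^+ b.+1) * G U b.+1)); last by ring.
by rewrite h2 h4; ring.
Qed.

(** [Th1_ratio] eliminates the first series of [pos_term]; then 1 - q^(U+d+1) is written as q^d (1 -
    q^(U+1)) + (1 - q^d). *)
Lemma pos_term_split U d :
  pos_term U d = q ^+ d * (Th (peq 1) U.+1 (U + d).+2 * (1 + q ^+ U.+1 - q ^+ U.+3)
                           - Th (peq 2) U.+1 (U + d).+2)
    + (1 - q ^+ d) * geo U.+1 * Th (peq 1) U.+1 (U + d).+2.
Proof.
apply: (@geo_lreg U.+1) => //.
rewrite /pos_term [Th (peq 2) U.+1 _]Thpeq_l -[2 - 1]/(1 : int).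
rewrite !mulrBr Th1_ratio; set X := Th (peq 1) U.+1 _; set Y := Th (peq 2) _ _.
rewrite [RHS]mulrDr [Z in _ = _ + Z](_ : _ = (1 - q ^+ d) * X); last first.
  by rewrite -[RHS]mul1r -[Z in _ = Z * _](@geoE U.+1) //; ring.
by rewrite -addSn !(exprS, exprD); ring.
Qed.

Lemma nn_phi_part U d :
  nn (Th (peq 1) U.+1 (U + d).+2 * (1 + q ^+ U.+1 - q ^+ U.+3)
      - Th (peq 2) U.+1 (U + d).+2).
Proof.
case: U => [|U].
  (* For first bound 1 the [peq 2] series is q times the [peq 1] series, and 1 - q^3 is a factor of
     the denominator. *)
  rewrite [Th (peq 2) _ _]Thpeq_l -[2 - 1]/(1 : int).
  rewrite (_ : Th (peq 2) 0 _ = 0); last first.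
    by rewrite (Th_eq 2) -ssum0; apply: eq_ssum => b; rewrite addn2 E0S mul0r.
  rewrite add0r [X in nn X](_ : _ = (1 - q ^+ 3) * Th (peq 1) 1 (0 + d).+2);
    last by ring.
  rewrite Th1_heine // mulrA; apply: nnM; first by apply: nn_mul1B_ip; lia.
  by apply: nn_ssum => j; apply: nn_qXM; apply: nnM; exact: nn_qb.
rewrite Th1_heine // Th2_heine // -mulrA -mulrBr subn1 subn2 /=.
rewrite (@phi_term_sum U.+2 (U + d) d) //.
have := @nn_phi_sum U d.
by rewrite (_ : U.+1 + (U + d).+3 = (U.+1 + (U + d).+2).+1)%N //; lia.
Qed.

Lemma nn_geo_part U d :
  nn ((1 - q ^+ d) * geo U.+1 * Th (peq 1) U.+1 (U + d).+2).
Proof.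
rewrite Th1_heine // subn1 /=.
have hs : summable (fun j => q ^+ (j * j + 3 * j).+1 * (qb U.+1 j.+1 * qb (U + d) j)).
  by apply: summable_qX => j; nia.
rewrite mulrA -ssumMl //; apply: nn_ssum => j.
have hg : geo U.+1 * qb U.+1 j.+1 = qb U j * geo j.+1.
  apply: (@geo_lreg j.+1) => //; rewrite mulrCA qb_diag mulrA [geo _ * _]mulrC geoE //.
  by rewrite mul1r mulrCA geoE ?mulr1.
set K := ip 2 _.
rewrite [X in nn X](_ : _ = q ^+ (j * j + 3 * j).+1 * ((1 - q ^+ d) * K
   * (geo U.+1 * qb U.+1 j.+1) * qb (U + d) j)); last by ring.
(* For d >= 2 the factor 1 - q^d occurs in [K]. For d = 1 it does not: it is cancelled by [geo 1]
   when j = 0, and through [qb_ip] otherwise. *)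
apply: nn_qXM; rewrite hg; case: d @K {hs} => [|[|d]] K.
- by rewrite expr0 subrr !mul0r; exact: nn0.
- case: j {hg} => [|j].
    rewrite !qbn0 !mulr1 mul1r mulrAC geoE // mul1r; exact: nn_ip.
  case: (ltnP U j.+1) => [Uj|jU].
    by rewrite (qb_small Uj) !(mul0r, mulr0); exact: nn0.
  rewrite expr1 [X in nn X](_ : _ = ((1 - q) * qb (U + 1) j.+1 * K)
     * (qb U j.+1 * geo j.+2)); last by ring.
  apply: nnM; last by apply: nnM; [exact: nn_qb | exact: nn_geo].
  have := @qb_ip j (U - j.+1) (U + 3).
  rewrite (_ : (j + (U - j.+1)).+2 = U + 1)%N; last by lia.
  rewrite /K (_ : (j + (U - j.+1)).+1 + (U + 3) = (U + (U + 1).+1).+1)%N; last by lia.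
  by move=> ->; apply: nnM; [apply: nnM|]; exact: nn_ip.
apply: nnM; last exact: nn_qb.
apply: nnM; first by apply: nn_mul1B_ip; lia.
by apply: nnM; [exact: nn_qb | exact: nn_geo].
Qed.

Lemma nn_pos_term U d : nn (pos_term U d).
Proof.
rewrite pos_term_split; apply: nnD; last exact: nn_geo_part.
by apply: nn_qXM; exact: nn_phi_part.
Qed.

Lemma nn_crank_sub_rank K : nn (crank_gf K - rank_gf K.+1).
Proof.
rewrite crank_sub_rank_pos_term; apply: nnD; first by apply: nnX; exact: nnq.
apply: nnD; first by apply: nn_qXM; exact: nn_Th.
by apply: nn_ssum => U; apply: nn_qXM; exact: nn_pos_term.
Qed.

Lemma nn_rank_sub_crank k : nn (rank_gf k - crank_gf k).
Proof.
rewrite rank_sub_crank; apply: nn_qXM; apply: nnD; first exact: nn_crank_sub_rank.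
apply: nn_ssum => e; apply: nn_qXM; apply: nnD; first exact: nn_Th.
by apply: nn_qXM; exact: nn_Th.
Qed.

(** * Counting partitions *)

Lemma mem_seqs_len b k s :
  (s \in seqs_len b k) = (size s == k) && all (fun x => 0 < x <= b)%N s.
Proof.
elim: k s => [|k IH] s; first by rewrite inE; case: s.
apply/allpairsP/idP => [[[x t] /= [hx ht ->]]|].
  by move: ht hx; rewrite IH mem_iota /= eqSS => /andP [-> ->]; lia.
case: s => // x t /= /and3P [sz hx ht]; exists (x, t) => /=; split=> //.
  by rewrite mem_iota; lia.
by rewrite IH ht andbT.
Qed.

Lemma uniq_seqs_len b k : uniq (seqs_len b k).
Proof.
elim: k => // k IH; apply: allpairs_uniq => //; first exact: iota_uniq.
by move=> [x s] [y t] _ _ /= [-> ->].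
Qed.

Lemma uniq_candidates n : uniq (candidates n).
Proof.
rewrite /candidates; move: (iota_uniq 0 n.+1); elim: (iota 0 n.+1) => //= k ks IH.
case/andP => kks uks; rewrite cat_uniq uniq_seqs_len IH // andbT /=.
apply/hasPn => s /flatten_mapP [k' hk']; rewrite !mem_seqs_len.
case/andP => /eqP sk' _; apply/negP => /andP [/eqP sk _].
by move: kks; rewrite -sk sk' hk'.
Qed.

Lemma sumn_size s : all (fun x => 0 < x)%N s -> (size s <= sumn s)%N.
Proof. by elim: s => //= x s IH /andP [x0 /IH]; lia. Qed.

Lemma sumn_mem s x : x \in s -> (x <= sumn s)%N.
Proof. by elim: s => //= y s IH; rewrite inE => /orP [/eqP ->|/IH]; lia. Qed.

Lemma mem_partitions n s : (s \in partitions n) = is_partition n s.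
Proof.
rewrite mem_filter andb_idr // => /and3P [_ pos /eqP sn].
have szn := sumn_size pos; rewrite sn in szn.
apply/flatten_mapP; exists (size s); first by rewrite mem_iota add0n ltnS.
rewrite mem_seqs_len eqxx; apply/allP => x xs.
by rewrite (allP pos x xs) /= -sn sumn_mem.
Qed.

Lemma uniq_partitions n : uniq (partitions n).
Proof. by rewrite filter_uniq ?uniq_candidates. Qed.

(** * Generating functions of partitions with bounded parts *)

Definition gfle (b : nat) (P : pred (seq nat)) : fps :=
  Fps (fun n => (count (fun s => P s && all (fun x => x <= b)%N s) (partitions n))%:Z).

Lemma eq_gfle b P Q :
  (forall s, sorted geq s -> all (fun x => 0 < x)%N s ->
     all (fun x => x <= b)%N s -> P s = Q s) -> gfle b P = gfle b Q.
Proof.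
move=> h; apply: fpsP => n /=; congr (_%:Z); apply: eq_in_count => s.
rewrite mem_partitions => /and3P [s1 s2 _].
by case: (boolP (all (fun x => x <= b)%N s)) => [s3|]; rewrite ?andbF // (h s).
Qed.

Lemma gfle_pred0 b : gfle b pred0 = 0.
Proof. by apply: fpsP => n /=; rewrite count_pred0. Qed.

Lemma co_gfle b n P : (n <= b)%N -> co (gfle b P) n = (count P (partitions n))%:Z.
Proof.
move=> nb /=; congr (_%:Z); apply: eq_in_count => s.
rewrite mem_partitions => /and3P [_ _ /eqP sn].
rewrite andb_idr // => _; apply/allP => x /sumn_mem; lia.
Qed.

Lemma gfle0 P : gfle 0 P = (P [::])%:R.
Proof.
apply: fpsP => -[|n].
  by rewrite /= /partitions /=; case: (P [::]).
rewrite /= (_ : co _ _ = 0); last by case: (P [::]).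
rewrite (@eq_in_count _ _ pred0) ?count_pred0 // => s.
rewrite mem_partitions => /and3P [_ pos /eqP sn].
case: s pos sn => [|x s] //= /andP [x0 _] _.
by rewrite leqNgt x0 andbF.
Qed.

(** A part [b.+1], if present, is the head of the sorted list, and deleting it is a bijection. *)
Lemma gfleS b P : gfle b.+1 P = gfle b P + q ^+ b.+1 * gfle b.+1 (fun s => P (b.+1 :: s)).
Proof.
apply: fpsP => n; rewrite coD co_qXM.
pose A s := P s && all (fun x => x <= b)%N s.
pose B s := [&& P s, all (fun x => x <= b.+1)%N s & b.+1 \in s].
have -> : co (gfle b.+1 P) n
    = (count A (partitions n))%:Z + (count B (partitions n))%:Z.
  rewrite -PoszD -count_predUI /= [X in (_ + X)%N](@eq_count _ _ pred0); last first.
    move=> s; rewrite /A /B /=; apply/negP => /andP [/andP [_ h] /and3P [_ _ hb]].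
    by have := allP h _ hb; rewrite ltnn.
  rewrite count_pred0 addn0; congr (_%:Z); apply: eq_count => s /=.
  rewrite /A /B; case: (P s) => //=; elim: s => //= x s ->; rewrite inE.
  by case: (ltngtP x b.+1) => hx; case: (all _ s); case: (all _ s);
    case: (_ \in s) => //=; lia.
congr (_ + _).
case: ltnP => [nb|bn].
  rewrite (@eq_in_count _ _ pred0) ?count_pred0 // => s.
  rewrite mem_partitions => /and3P [_ _ /eqP sn]; apply/negP => /and3P [_ _].
  by move/sumn_mem; lia.
congr (_%:Z); rewrite -!size_filter -[RHS](size_map (cons b.+1)).
apply: perm_size; apply: uniq_perm.
- exact: filter_uniq (uniq_partitions _).
- rewrite map_inj_uniq; first exact: filter_uniq (uniq_partitions _).
  by move=> x y [].
move=> s; rewrite mem_filter mem_partitions; apply/idP/mapP.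
  case/andP => /and3P [Ps sb bs] /and3P [so pos /eqP sn].
  case: s Ps sb bs so pos sn => // x t /= Ps /andP [xb tb] bs so /andP [x0 pos] sn.
  have xE : x = b.+1.
    move: bs; rewrite inE => /orP [/eqP -> //|bt].
    have := order_path_min (rev_trans leq_trans) so => /allP /(_ _ bt) /=; lia.
  subst x; exists t => //; rewrite mem_filter mem_partitions Ps tb /= /is_partition.
  by rewrite (path_sorted so) pos /=; lia.
case=> t; rewrite mem_filter mem_partitions.
case/andP => /andP [Pt tb] /and3P [so pos /eqP tn] ->.
rewrite /B /= Pt inE eqxx leqnn tb /is_partition /= pos path_min_sorted ?so //=.
by rewrite tn; lia.
Qed.

Lemma largest_le b s : all (fun x => x <= b)%N s -> (largest_part s <= b)%N.
Proof. by elim: s => //= x s IH /andP [xb /IH]; rewrite geq_max xb. Qed.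

Lemma largest_cons b s :
  all (fun x => x <= b)%N s -> largest_part (b :: s) = b.
Proof. by move/largest_le => h; apply/maxn_idPl. Qed.

Lemma gfle_size b i : gfle b (fun s => (size s <= i)%N) = G b i.
Proof.
elim: b i => [|b IHb] i; first by rewrite gfle0.
elim: i => [|i IHi]; rewrite gfleS IHb.
  rewrite (@eq_gfle _ _ pred0) ?gfle_pred0 ?mulr0 ?addr0 ?Gn0 //.
by rewrite GSS -IHi.
Qed.

(** The sum runs over the largest part L + 1; the constant term is the empty partition, of rank
    0. *)
Lemma gfle_rank (k b : nat) :
  gfle b (fun s => k%:Z <= rank s)
  = (k == 0)%N%:R + \sum_(L < b) (k <= L)%N%:R * (q ^+ L.+1 * G L.+1 (L - k)).
Proof.
elim: b => [|b IH].
  rewrite gfle0 big_ord0 addr0; congr (_%:R); rewrite /rank /=; lia.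
rewrite gfleS IH big_ord_recr -addrA /=; congr (_ + (_ + _)).
rewrite (@eq_gfle _ _ (fun s => (k <= b)%N && (size s <= b - k)%N)); last first.
  by move=> s _ _ hs; rewrite /rank largest_cons //=; lia.
case: (k <= b)%N; last by rewrite (@eq_gfle _ _ pred0) // gfle_pred0 mulr0 mul0r.
by rewrite mul1r; congr (_ * _); exact: gfle_size.
Qed.

Lemma count_rank (k n : nat) : (0 < n)%N ->
  (count (fun s => k%:Z <= rank s) (partitions n))%:Z = co (rank_gf k) n.
Proof.
move=> n0; rewrite -(@co_gfle (k + n.+1)); last by lia.
rewrite gfle_rank coD (_ : co (k == 0)%N%:R n = 0) ?add0r; last first.
  by case: (k == 0)%N => //=; rewrite (_ : (n == 0)%N = false) //; lia.
rewrite (@co_ssum _ n.+1) //; last by move=> i; apply: ordXM; lia.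
rewrite co_sum big_split_ord big1 ?[LHS]add0r; last first.
  move=> i _; rewrite (_ : nat_of_ord (lshift _ i) = i) //.
  by rewrite leqNgt ltn_ord mul0r.
apply: eq_bigr => i _; rewrite (_ : nat_of_ord (rshift k i) = k + i)%N //.
by rewrite leq_addr mul1r addKn.
Qed.

Lemma gfle_ones b m : gfle b.+1 (fun s => count (pred1 1%N) s == m) = q ^+ m * ip 2 b.
Proof.
elim: b m => [|b IH] m.
  rewrite ip0 mulr1; elim: m => [|m IHm]; rewrite gfleS gfle0 /=.
    by rewrite (@eq_gfle _ _ pred0) // gfle_pred0 mulr0 addr0.
  rewrite add0r expr1 exprS -IHm; congr (_ * _).
apply: (@geo_lreg b.+2) => //.
by rewrite mulrBl mul1r {1}gfleS [RHS]mulrCA -[X in q ^+ X](add2n b) ipSr // -IH addrK.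
Qed.

Lemma gfle_ones_gt w u m :
  gfle (w.+1 + u) (fun s => (count (pred1 1%N) s == w.+1)
                  && (count (fun x => w.+1 < x)%N s == m))
  = q ^+ w.+1 * ip 2 w * (q ^+ (w.+1 * m) * E u m).
Proof.
elim: u m => [|u IHu] m.
  rewrite addn0 -gfle_ones (_ : E 0 m = (m == 0)%N%:R) //.
  case: m => [|m].
    rewrite muln0 !mulr1; apply: eq_gfle => s _ _ /allP hs.
    rewrite andb_idr // => _; rewrite eqn0Ngt -has_count.
    by apply/hasPn => x /hs; rewrite -leqNgt.
  rewrite !mulr0 -(gfle_pred0 w.+1); apply: eq_gfle => s _ _ /allP hs.
  apply/negP => /andP [_ /eqP h].
  have : (0 < count (fun x => w.+1 < x)%N s)%N by rewrite h.
  by rewrite -has_count => /hasP [x /hs]; lia.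
elim: m => [|m IHm].
  rewrite addnS gfleS IHu !E0 muln0 (@eq_gfle _ _ pred0) ?gfle_pred0 ?mulr0 ?addr0 //.
  by move=> s _ _ _ /=; rewrite (_ : (w.+1 < (w.+1 + u).+1)%N) ?andbF //; lia.
rewrite addnS gfleS IHu ESS.
transitivity (q ^+ w.+1 * ip 2 w * (q ^+ (w.+1 * m.+1) * E u m.+1)
   + q ^+ (w.+1 + u).+1 * (q ^+ w.+1 * ip 2 w * (q ^+ (w.+1 * m) * E u.+1 m))).
  rewrite -IHm addnS; congr (_ + _ * _); apply: eq_gfle => s _ _ _ /=.
  by rewrite (_ : (w.+1 < (w.+1 + u).+1)%N) //; lia.
rewrite mulnS -addnS !exprD; ring.
Qed.

Lemma ord_iq_G u a : ord (iq a - G u a) u.+1.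
Proof.
elim: a => [|a IH]; first by rewrite iq0 Gn0 subrr => n.
have -> : iq a.+1 - G u a.+1
    = geo a.+1 * ((iq a - G u a) + q ^+ (u + a).+1 * G u a).
  apply: (@geo_lreg a.+1) => //; rewrite mulrBr iqE G_ratio_r mulrA geoE //.
  by rewrite mul1r; ring.
by apply: ordM; apply: ordD => //; apply: ordXM; rewrite ltnS leq_addr.
Qed.

Lemma co_E_iq n m a : co (a * E n.+1 m) n = co (a * (q ^+ m * iq m)) n.
Proof.
apply/eqP; rewrite -subr_eq0 -coB ES -mulrBr -mulrBr -opprB mulrN mulrN coN.
by rewrite (@ordM _ _ n.+1) ?oppr0 //; apply: ordM; exact: ord_iq_G.
Qed.

Lemma gfle_ones0_largest k b : (0 < k)%N ->
  gfle (k.+1 + b) (fun s => (count (pred1 1%N) s == 0) && (largest_part s == k.+1))%N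
  = q ^+ k.+1 * ip 2 k.
Proof.
move=> k0; elim: b => [|b IH].
  rewrite addn0 gfleS (@eq_gfle _ _ pred0) ?gfle_pred0 ?add0r; last first.
    by move=> s _ _ /largest_le hs; apply/negP => /andP [_ /eqP]; lia.
  rewrite -[ip 2 k]mul1r -[1](expr0 q) -gfle_ones; congr (_ * _).
  apply: eq_gfle => s _ _ hs; rewrite largest_cons // eqxx andbT /=.
  by rewrite (_ : (k.+1 == 1)%N = false) //; lia.
rewrite addnS gfleS IH (@eq_gfle _ _ pred0) ?gfle_pred0 ?mulr0 ?addr0 //.
by move=> s _ _ hs; rewrite largest_cons //; apply/negP => /andP [_ /eqP]; lia.
Qed.

Lemma count_ones0_largest k n : (1 < n)%N ->
  (count (fun s => (count (pred1 1%N) s == 0) && (largest_part s == k.+1))%N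
     (partitions n))%:Z = co (q ^+ k.+1 * ip 2 k) n.
Proof.
move=> n1; case: k => [|k]; last first.
  by rewrite -(@gfle_ones0_largest k.+1 n) // co_gfle //; lia.
(* Largest part 1 without ones is impossible, whereas the series is q; the two agree because n >
   1. *)
rewrite ip0 mulr1 co_qX (_ : (n == 1)%N = false); last by lia.
rewrite (@eq_in_count _ _ pred0) ?count_pred0 // => s.
rewrite mem_partitions => /and3P [so pos /eqP sn]; apply/negP => /andP [c1 /eqP l1].
case: s so pos sn c1 l1 => [|x s] //= _ /andP [x0 _] _ c1 l1.
have x1 : (x <= 1)%N by rewrite -l1 leq_maxl.
by rewrite (_ : (x == 1)%N = true) in c1; lia.
Qed.

Lemma count_fibers (T : Type) (g : T -> nat) (P : pred T) (l : seq T) B :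
  all (fun s => g s < B)%N l ->
  (count P l)%:Z = \sum_(w < B) (count (fun s => (g s == w) && P s) l)%:Z.
Proof.
elim: l => [|s l IH] /=; first by rewrite big1.
case/andP => gs /IH; rewrite PoszD => ->.
under [RHS]eq_bigr do rewrite PoszD.
rewrite big_split /=; congr (_ + _).
rewrite (bigD1 (Ordinal gs)) //= eqxx big1 ?addr0 // => i hi.
by rewrite (_ : (g s == i) = false) //; apply/negbTE; rewrite eq_sym; exact: hi.
Qed.

(** Generating function of the crank numbers [M(k, n)] for [k > 0], [n > 1];
    the summand is indexed by the number of ones. *)
Definition crank_eq_gf (k : nat) : fps :=
  ssum (fun w => q ^+ (w + w.+1 * (w + k)) * ((1 - q) * iq w * iq (w + k))).

Lemma ip2_iq w : ip 2 w = (1 - q) * iq w.+1.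
Proof. by rewrite iq_ip -[1 - q]/(1 - q ^+ 1) ipSl. Qed.

Lemma count_crank_eq k n : (1 < n)%N ->
  (count (fun s => crank s == k.+1%:Z) (partitions n))%:Z = co (crank_eq_gf k.+1) n.
Proof.
move=> n1.
rewrite (@count_fibers _ (count (pred1 1%N)) _ _ n.+1); last first.
  apply/allP => s; rewrite mem_partitions => /and3P [_ pos /eqP sn].
  by rewrite ltnS (leq_trans (count_size _ _)) // -sn sumn_size.
rewrite (@co_ssum _ n.+1) //; last by move=> w; apply: ordXM; lia.
rewrite !big_ord_recl; congr (_ + _).
  rewrite [nat_of_ord _]/= iq0 mulr1 mul1n !add0n -ip2_iq -count_ones0_largest //.
  congr (_%:Z); apply: eq_count => s /=; rewrite /crank.
  by case: eqP.
apply: eq_bigr => w _.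
rewrite (_ : nat_of_ord (lift ord0 w) = w.+1) // -ip2_iq.
transitivity (co (gfle (w.+1 + n.+1) (fun s => (count (pred1 1%N) s == w.+1)
                  && (count (fun x => w.+1 < x)%N s == w.+1 + k.+1)%N)) n).
  rewrite co_gfle; last by lia.
  congr (_%:Z); apply: eq_count => s /=; rewrite /crank.
  by case: eqP => //= -> /=; lia.
rewrite gfle_ones_gt mulrA co_E_iq; congr (co _ n).
by rewrite !mulSn !exprD; ring.
Qed.

(** Identifies [crank_gf] as the tail sum of the series for single crank values; the summands agree
    up to the telescoping [g]. *)
Lemma crank_gf_diff K : crank_gf K - crank_gf K.+1 = crank_eq_gf K.+1.
Proof.
pose B e := q ^+ (e.+1 * (e + K).+1) * (iq (e + K).+1 * iq e).
have hB : summable B by move=> e; apply: ordXM; nia.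
pose g e := (1 - q ^+ e) * B e.
have hg : summable g by move=> e; apply: ordM.
have g0 : g 0%N = 0 by rewrite /g expr0 subrr mul0r.
transitivity (ssum (fun e => B e - q ^+ e.+1 * B e - g e) + ssum (fun e => g e - g e.+1)).
  rewrite -ssumD -ssumB; apply: eq_ssum => e.
  have hi : iq (e + K).+1 = iq (e + K).+2 - q ^+ (e + K).+2 * iq (e + K).+2.
    by rewrite -iqE; ring.
  have hg1 : g e.+1 = q ^+ (e.+1 * (e + K).+1 + e.+1 + (e + K).+2) * (iq (e + K).+2 * iq e).
    rewrite /g /B addSn (_ : e.+2 * (e + K).+2 = e.+1 * (e + K).+1 + e.+1 + (e + K).+2)%N;
      last by lia.
    by rewrite -(iqE e); ring.
  rewrite !Th_all hg1 addnS (_ : e.+1 * (e + K).+2 = e.+1 * (e + K).+1 + e.+1)%N; last by lia.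
  have -> : q ^+ e.+1 * B e = q ^+ (e.+1 * (e + K).+1) * q ^+ e.+1 *
      ((iq (e + K).+2 - q ^+ (e + K).+2 * iq (e + K).+2) * iq e).
    by rewrite -hi /B; ring.
  rewrite /B !exprD; ring.
rewrite ssum_telescope // g0 addr0; apply: eq_ssum => e.
by rewrite /g /B addnS exprD exprS; ring.
Qed.

Lemma rank_ge n s : s \in partitions n -> - n%:Z <= rank s.
Proof.
rewrite mem_partitions => /and3P [_ pos /eqP sn].
by have := sumn_size pos; rewrite sn /rank; lia.
Qed.

Lemma crank_bounds n s : s \in partitions n -> - n%:Z <= crank s <= n%:Z.
Proof.
rewrite mem_partitions => /and3P [_ pos /eqP sn].
have hs := sumn_size pos; rewrite sn in hs.
have hl : (largest_part s <= n)%N.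
  by apply: largest_le; apply/allP => x /sumn_mem; rewrite sn.
have h1 := leq_trans (count_size (pred1 1%N) s) hs.
rewrite /crank; case: eqP => _; first by lia.
have := leq_trans (count_size (fun x => count (pred1 1%N) s < x)%N s) hs.
move: h1; set a := count _ _; set b := count _ _; lia.
Qed.

Lemma count_crank K n : (1 < n)%N ->
  (count (fun s => K.+1%:Z <= crank s) (partitions n))%:Z = co (crank_gf K) n.
Proof.
(* Downward induction on K, starting at K >= n, where no crank reaches K + 1 and the series starts
   beyond q^n. *)
move=> n1; have [d] : {d | n <= K + d}%N by exists n; rewrite leq_addl.
elim: d K => [|d IH] K hK.
  rewrite (@eq_in_count _ _ pred0); last first.
    by move=> s /crank_bounds /andP [_ h] /=; apply/negbTE; lia.
  rewrite count_pred0; symmetry; have : ord (crank_gf K) K.+1; last by apply; lia.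
  by apply: ord_ssum => e; apply: ordXM; nia.
rewrite -[crank_gf K](subrK (crank_gf K.+1)) crank_gf_diff coD -count_crank_eq // -IH; last by lia.
rewrite -PoszD -count_predUI [X in (_ + X)%N](@eq_count _ _ pred0); last first.
  by move=> s /=; apply/negbTE; lia.
by rewrite count_pred0 addn0; congr (_%:Z); apply: eq_count => s /=; lia.
Qed.

(** * From cumulative functions to complementary counts *)

Lemma sum_count_le (T : eqType) (f : T -> int) (l : seq T) (m : int) (n : nat) :
  0 <= m + n%:Z + 1 -> (forall s, s \in l -> - n%:Z <= f s) ->
  \sum_(i < nat_of_int_trunc (m + n%:Z + 1))
     (count (fun s => f s == m - i%:Z) l)%:Z
  = (size l)%:Z - (count (fun s => (m + 1) <= f s) l)%:Z.
Proof.
case hB: (m + n%:Z + 1) => [B|//] _.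
elim: l => [|s l IH] hl /=; first by rewrite big1.
under eq_bigr do rewrite PoszD.
rewrite big_split /= IH; last by move=> t tl; apply: hl; rewrite inE tl orbT.
have hs : - n%:Z <= f s by apply: hl; rewrite inE eqxx.
rewrite (_ : \sum_(i < B) _ = (f s <= m)%R%:Z); first by lia.
case: (lerP (f s) m) => fm; last first.
  by rewrite big1 // => i _; rewrite (_ : (f s == _) = false) //; lia.
(* The only index that counts [s] is m - f s; it is in range because f s >= -n. *)
have hi : (absz (m - f s) < B)%N by lia.
rewrite (bigD1 (Ordinal hi)) //= big1 ?addr0; first by lia.
move=> i; rewrite -val_eqE /= => ni.
by rewrite (_ : (f s == _) = false) //; lia.
Qed.

Lemma Nle_count (m : int) n : 0 <= m + n%:Z + 1 ->
  Nle m n = (size (partitions n))%:Z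
            - (count (fun s => m + 1 <= rank s) (partitions n))%:Z.
Proof. by move=> h; apply: sum_count_le => // s; exact: rank_ge. Qed.

Lemma Mle_count (m : int) n : (1 < n)%N -> 0 <= m + n%:Z + 1 ->
  Mle m n = (size (partitions n))%:Z
            - (count (fun s => m + 1 <= crank s) (partitions n))%:Z.
Proof.
move=> n1 h; rewrite -(@sum_count_le _ crank _ _ n) //; last first.
  by move=> s /crank_bounds /andP [].
by apply: eq_bigr => i _; rewrite /Mcrank gtn_eqF.
Qed.

Lemma Nle1 (m : int) : -1 <= m -> Nle m 1 = (0 <= m)%R%:Z.
Proof.
move=> hm; rewrite Nle_count; last by lia.
rewrite (_ : partitions 1 = [:: [:: 1%N]]) //= /rank /=; lia.
Qed.

Lemma Mle1 (m : nat) : Mle m 1 = (0 < m)%N.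
Proof.
rewrite /Mle /cumul (_ : m%:Z + 1%N%:Z + 1 = m.+2); last by lia.
rewrite [nat_of_int_trunc _]/=; case: m => [|m].
  by rewrite !big_ord_recr big_ord0.
(* Only the last three indices, for the crank values 1, 0 and -1, contribute: 1 - 1 + 1. *)
rewrite !big_ord_recr big1 /Mcrank /=; last first.
  move=> i _; have hi := ltn_ord i.
  by rewrite !ifF //; [apply/negbTE|]; lia.
have e1 : m.+1%:Z - m%:Z = 1 by lia.
have e2 : m.+1%:Z - m.+1%:Z = 0 by lia.
have e3 : m.+1%:Z - m.+2%:Z = -1 by lia.
by rewrite e1 e2 e3.
Qed.

Theorem theorem3p1 (m : int) (n : nat) (hm : 0 <= m) (hn : (1 <= n)%N) :
  Mle m n <= Nle m n /\ Nle (m - 1) n <= Mle m n.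
Proof.
case: m hm => // m _; case: (ltngtP n 1) => [|n1|->]; first by lia.
  rewrite Mle_count ?Nle_count; try lia.
  rewrite subrK (_ : m%:Z + 1 = m.+1); last by lia.
  rewrite !count_rank // count_crank //.
  (* Complementing reverses the inequalities: the crank count at threshold m + 1 lies between the
     rank counts at m + 1 and m. *)
  have h1 := nn_crank_sub_rank m n; have h2 := nn_rank_sub_crank m n.
  rewrite coB in h1; rewrite coB in h2; split; lia.
(* For n = 1 the three values are 1, [m > 0] and [m > 0]. *)
rewrite Mle1 !Nle1; lia.
Qed.
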